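(* Let $n$ be a positive integer and let $(M_i,p_i)$ be a sequence of pointed complete $n$-dimensional Riemannian manifolds with $\mathrm{Ric} \ge -(n-1)$, converging in the pointed Gromov-Hausdorff sense to $(X,p)$. Let $\tilde X$ be the universal cover of $X$, and let $\tilde p\in\tilde X$ be a lift of $p$. Then, after passing to a subsequence, there exist $R_i \to \infty$ and covering spaces $\hat B(p_i,R_i)$ of the closed balls $\bar B_{R_i}(p_i)\subset M_i$, with base points $\hat p_i \in \hat B(p_i,R_i)$ lying over $p_i$, such that $(\hat B(p_i,R_i),\hat p_i)$ converges in the pointed Gromov-Hausdorff sense to $(\tilde X,\tilde p)$.
   Context: Manifolds are connected. The limit $X$ is a length space, and $\tilde X$ carries the length metric lifted from $X$, so that $\tilde X\to X$ is a local isometry. The covering spaces $\hat B(p_i,R_i)$ carry the length metrics lifted from the balls $\bar B_{R_i}(p_i)$. *)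

(* Defs.v *)
From mathcomp Require Import all_boot all_order all_algebra.
From mathcomp Require Import all_classical all_reals all_analysis.
Set Implicit Arguments.
Unset Strict Implicit.
Unset Printing Implicit Defensive.
Import Order.TTheory GRing.Theory Num.Theory.
Import numFieldTopology.Exports numFieldNormedType.Exports.
Local Open Scope classical_set_scope.
Local Open Scope ring_scope.

(** * Smooth functions on open subsets of [R^n] *)

Definition partial (R : realType) (n : nat) (j : 'I_n) (f : 'rV[R]_n -> R) :
  'rV[R]_n -> R := fun x => 'D_(delta_mx 0 j) f x.

(* [f] is only constrained on [U]: for [U] open, the iterated partial
   derivatives at a point of [U] do not depend on the values of [f] outside. *)
Definition smooth_on (R : realType) (n : nat) (U : set 'rV[R]_n)
    (f : 'rV[R]_n -> R) : Prop :=
  forall (s : seq 'I_n) (x : 'rV[R]_n), U x ->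
    {for x, continuous (foldr (@partial R n) f s)} /\
    (forall j : 'I_n, derivable (foldr (@partial R n) f s) x (delta_mx 0 j)).

(** * Curvature of a metric given in coordinates *)

Section Curvature.
Variables (R : realType) (n : nat) (g : 'rV[R]_n -> 'M[R]_n).

(* [christoffel k i j] is Gamma^k_{ij}. *)
Definition christoffel (k i j : 'I_n) (u : 'rV[R]_n) : R :=
  2^-1 * \sum_(l < n) invmx (g u) k l *
    (partial i (fun w => g w j l) u + partial j (fun w => g w i l) u
     - partial l (fun w => g w i j) u).

(* [riemann l i j k] is the component R^l_{ijk} of the curvature tensor, with
   the convention R(d_i, d_j) d_k = \sum_l R^l_{ijk} d_l, where
   R(V, W) = [nabla_V, nabla_W] - nabla_[V, W]. *)
Definition riemann (l i j k : 'I_n) (u : 'rV[R]_n) : R :=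
  partial i (christoffel l j k) u - partial j (christoffel l i k) u
  + \sum_(m < n) (christoffel m j k u * christoffel l i m u
                  - christoffel m i k u * christoffel l j m u).

(* Ric(V, W) is the trace of Z |-> R(Z, V) W. *)
Definition ricci (u : 'rV[R]_n) : 'M[R]_n :=
  \matrix_(j < n, k < n) \sum_(i < n) riemann i i j k u.

End Curvature.

Definition qform (R : realType) (n : nat) (A : 'M[R]_n) (v : 'rV[R]_n) : R :=
  (v *m A *m v^T) 0 0.

(** * Riemannian manifolds *)

Record chart (R : realType) (n : nat) (M : topologicalType) := Chart {
  ch_dom : set M;
  ch_map : M -> 'rV[R]_n;
  ch_inv : 'rV[R]_n -> M;
  ch_dom_open : open ch_dom;
  ch_img_open : open (ch_map @` ch_dom);
  ch_mapK : forall x, ch_dom x -> ch_inv (ch_map x) = x;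
  ch_map_cont : {within ch_dom, continuous ch_map};
  ch_inv_cont : {within ch_map @` ch_dom, continuous ch_inv}
}.

Definition transition (R : realType) (n : nat) (M : topologicalType)
    (c d : chart R n M) : 'rV[R]_n -> 'rV[R]_n :=
  fun u => ch_map d (ch_inv c u).

Definition overlap (R : realType) (n : nat) (M : topologicalType)
    (c d : chart R n M) : set 'rV[R]_n :=
  ch_map c @` (ch_dom c `&` ch_dom d).

Section Lengths.
Variables (R : realType) (n : nat) (M : topologicalType) (I : Type).
Variables (phi : I -> chart R n M) (g : I -> 'rV[R]_n -> 'M[R]_n).

Definition C1_at (eta : R -> M) (t : R) : Prop :=
  {for t, continuous eta} /\
  forall i, ch_dom (phi i) (eta t) ->
    (\forall s \near t, derivable (fun r => ch_map (phi i) (eta r)) s 1) /\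
    {for t, continuous (derive1 (fun r => ch_map (phi i) (eta r)))}.

Definition speed_in (i : I) (eta : R -> M) (t : R) : R :=
  Num.sqrt (qform (g i (ch_map (phi i) (eta t)))
                  (derive1 (fun r => ch_map (phi i) (eta r)) t)).

(* [pw_C1_length x y L]: some concatenation of finitely many C^1 arcs, each
   parametrized by [0, 1], leads from [x] to [y] and has length [L].  An arc is
   C^1 at every point of [0, 1], i.e. on an open neighbourhood of it; [v] is its
   speed, measured in any of the charts around the current point. *)
Inductive pw_C1_length : M -> M -> \bar R -> Prop :=
| pw_C1_nil x : pw_C1_length x x 0%E
| pw_C1_cons (eta : R -> M) (v : R -> R) (y : M) (L : \bar R) :
    (forall t, 0 <= t <= 1 -> C1_at eta t) ->
    (forall t i, 0 <= t <= 1 -> ch_dom (phi i) (eta t) ->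
       v t = speed_in i eta t) ->
    pw_C1_length (eta 1) y L ->
    pw_C1_length (eta 0) y
      (\int[lebesgue_measure]_(t in `[0%R, 1%R]) (v t)%:E + L)%E.

End Lengths.

(* A connected Riemannian manifold (without boundary), presented as a metric
   space whose distance is the Riemannian distance; its manifold topology is the
   metric one.  [rm_metric i] is the matrix of the metric tensor in chart [i].
   Vectors are rows, so ['J f u] is the transpose of the usual Jacobian matrix.
   Second countability is automatic, the space being metrizable, connected and
   locally Euclidean. *)
Record riemannian_manifold (R : realType) (n : nat) := RiemannianManifold {
  rm_space :> metricType R;
  rm_index : Type;
  rm_chart : rm_index -> chart R n rm_space;
  rm_metric : rm_index -> 'rV[R]_n -> 'M[R]_n;
  rm_connected : connected [set: rm_space];
  rm_cover : forall x : rm_space, exists i, ch_dom (rm_chart i) x;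
  rm_smooth : forall (i j : rm_index) (k : 'I_n),
    smooth_on (overlap (rm_chart i) (rm_chart j))
      (fun u => transition (rm_chart i) (rm_chart j) u 0 k);
  rm_metric_smooth : forall (i : rm_index) (k l : 'I_n),
    smooth_on (ch_map (rm_chart i) @` ch_dom (rm_chart i))
      (fun u => rm_metric i u k l);
  rm_metric_sym : forall i u,
    (ch_map (rm_chart i) @` ch_dom (rm_chart i)) u ->
    (rm_metric i u)^T = rm_metric i u;
  rm_metric_pos : forall i u (v : 'rV[R]_n),
    (ch_map (rm_chart i) @` ch_dom (rm_chart i)) u ->
    v != 0 -> 0 < qform (rm_metric i u) v;
  rm_metric_compat : forall i j u,
    overlap (rm_chart i) (rm_chart j) u ->
    let tau := transition (rm_chart i) (rm_chart j) in
    rm_metric i u = 'J tau u *m rm_metric j (tau u) *m ('J tau u)^T;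
  rm_distance : forall x y : rm_space,
    (mdist x y)%:E =
    ereal_inf [set L | pw_C1_length rm_chart rm_metric x y L]
}.

Definition ricci_bounded_below (R : realType) (n : nat)
    (M : riemannian_manifold R n) (kappa : R) : Prop :=
  forall (i : rm_index M) (u v : 'rV[R]_n),
    (ch_map (rm_chart i) @` ch_dom (rm_chart i)) u ->
    kappa * qform (rm_metric i u) v <= qform (ricci (rm_metric i) u) v.

(** * Metric spaces *)

(* The library's complete types are pointed, hence this unpointed version. *)
Definition complete_space (T : uniformType) : Prop :=
  forall F : set_system T, ProperFilter F -> cauchy F -> exists x : T, F --> x.

Definition mclosed_ball (R : realType) (T : metricType R) (x : T) (r : R) :
  set T := [set y | mdist x y <= r].

(* The length on [0, 1], as the supremum of the lengths of inscribed polygons. *)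
Definition curve_length (R : realType) (T : metricType R) (gamma : R -> T) :
  \bar R :=
  ereal_sup [set (\sum_(0 <= k < size s)
                    mdist (gamma (nth 1 (0 :: s) k))
                          (gamma (nth 1 (0 :: s) k.+1)))%:E
            | s in itv_partition 0 1].

Definition is_path (R : realType) (T : topologicalType) (x y : T)
    (gamma : R -> T) : Prop :=
  [/\ {within `[0, 1], continuous gamma}, gamma 0 = x & gamma 1 = y].

(* The metric of [E] is the length metric lifted along [pi]: distances in [E]
   are infima, over the paths of [E], of the lengths of their projections.
   When the image of [pi] is a proper subset of [T], the lengths of curves in it
   are the same for the restricted metric and for its own length metric. *)
Definition lifted_length_metric (R : realType) (E T : metricType R)
    (pi : E -> T) : Prop :=
  forall x y : E, (mdist x y)%:E =
    ereal_inf [set curve_length (pi \o gamma) | gamma in is_path x y].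

Definition length_space (R : realType) (T : metricType R) : Prop :=
  lifted_length_metric (@id T).

(* Pointed Gromov-Hausdorff convergence through approximations
   (Burago-Burago-Ivanov, Definition 8.1.1). *)
Definition pointed_GH_cvg (R : realType) (Y : nat -> metricType R)
    (y : forall i, Y i) (Z : metricType R) (z : Z) : Prop :=
  forall r e : R, 0 < r -> 0 < e ->
  \forall i \near \oo, exists f : Y i -> Z,
    [/\ f (y i) = z,
        forall a b : Y i, ball (y i) r a -> ball (y i) r b ->
          `|mdist (f a) (f b) - mdist a b| < e
      & forall w : Z, ball z (r - e) w ->
          exists2 a : Y i, ball (y i) r a & mdist (f a) w < e].
Arguments pointed_GH_cvg {R} Y y {Z} z.

(** * Covering spaces *)

(* [pi] is a covering map from [E] onto the subspace [A] of [T]. The set [F] is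
   the family of sheets over [A `&` U], and [s] is the inverse of [pi] on a
   sheet. *)
Definition covering_onto (E T : topologicalType) (A : set T) (pi : E -> T) :
  Prop :=
  [/\ continuous pi, range pi = A
    & forall x, A x -> exists U : set T, [/\ open U, U x
      & exists F : set (set E),
        [/\ trivIset F id, \bigcup_(S in F) S = pi @^-1` U
          & forall S, F S -> open S /\ exists s : T -> E,
            [/\ {within A `&` U, continuous s},
                forall z, (A `&` U) z -> S (s z) /\ pi (s z) = z
              & forall e, S e -> s (pi e) = e]]]].

(* Universal covers in the sense of Spanier: connected covers that cover every
   connected cover.  They are not assumed to be simply connected. *)
Definition universal_cover (E T : topologicalType) (pi : E -> T) : Prop :=
  [/\ connected [set: E], covering_onto [set: T] pi
    & forall (E' : topologicalType) (pi' : E' -> T),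
        connected [set: E'] -> covering_onto [set: T] pi' ->
        exists f : E -> E', continuous f /\ pi' \o f = pi].

(* Main.v *)
(* The covers are pulled back from [pi : Xt -> X].

   The Riemannian distance is a length metric, so by the theorem of Hopf, Rinow
   and Cohn-Vossen closed balls of the [M i] are compact and points are joined by
   minimal geodesics; being a complete limit, [X] is proper as well.  Hence there
   is a uniform radius at which [pi] is evenly covered over a given ball of [X].
   If [f : M i -> X] is a Gromov-Hausdorff approximation much finer than that
   radius then, although [f] is discontinuous, the pairs [(a, y)] with
   [pi y = f a] form a covering of the closed ball of [M i]: the sheet of
   [(a, y)] over a nearby point [b] is the lift of [f b] closest to [y].  Its
   component through the base point, with the lifted length metric, is the
   required cover, and [(a, y) |-> y] is the required approximation: lengths of
   paths are compared by chains of short steps, whose number is bounded in terms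
   of the radius alone. *)
Require Import Defs.
From HB Require Import structures.
From mathcomp Require Import all_boot all_order all_algebra.
From mathcomp Require Import all_classical all_reals all_analysis.
From mathcomp Require Import ring lra measurable_realfun.
Set Implicit Arguments.
Unset Strict Implicit.
Unset Printing Implicit Defensive.
Import Order.TTheory GRing.Theory Num.Theory.
Import numFieldTopology.Exports numFieldNormedType.Exports.
Local Open Scope classical_set_scope.
Local Open Scope ring_scope.

(** * Curves and their lengths *)

(** The constants are fixed in the order [K] and [t], then [r], then the lifting radius and [h],
    then the number [N] of steps, then the fineness [e], so that [N] errors of a few [e] each stay
    below [t]. The discontinuity of [f] is harmless because of a gap: over a displacement below [h]
    in the base, the [Y]-coordinates of two points of the pullback are at distance less than [2 * h]
    or at least [8 * h]. Paths in the pullback are thus asked to be continuous only in [M], with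
    jumps below [4 * h] in [Y]; such jumps cannot cross the gap. A second obstacle is that the balls
    are closed and carry their own length metric. Short paths inside a ball between nearby points
    have to be constructed up to the boundary, and distances are compared only over radius [K], deep
    enough inside radius [r] for minimal geodesics of [M] to stay in the ball. In [Y] and in the
    covers, intermediate points are used only up to an arbitrarily small error. *)

(** A supremum argument. The step yields [P] at [t] itself as well as beyond it, so it contains both
    the base case, where its premise is vacuous, and the limit case. *)
Lemma real_induction (R : realType) (P : R -> Prop) :
  (forall t, 0 <= t <= 1 -> (forall s, 0 <= s < t -> P s) ->
     exists2 eta, 0 < eta & forall s, t <= s < t + eta -> s <= 1 -> P s) ->
  forall t, 0 <= t <= 1 -> P t.
Proof.
move=> step t0 /andP[t00 t01].
pose S := [set t : R | 0 <= t <= 1 /\ forall s, 0 <= s <= t -> P s].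
have S1 : ubound S 1 by move=> t [/andP[]].
have S0 : S 0.
  split; first by rewrite lexx ler01.
  move=> s /andP[s0 s0']; have -> : s = 0 by apply/eqP; rewrite eq_le s0' s0.
  have [|u /andP[u0] /lt_le_trans /(_ u0)|e e0] := step 0; rewrite ?lexx ?ler01 ?ltxx//.
  by apply; rewrite ?lexx ?add0r ?e0 ?ler01.
have hS : has_sup S by split; [exists 0 | exists 1].
have sup01 : 0 <= sup S <= 1.
  by rewrite ub_le_sup ?ge_sup//; [exists 0|exists 1].
have below : forall s, 0 <= s < sup S -> P s.
  move=> s /andP[s0 ss]; have e0 : 0 < sup S - s by rewrite subr_gt0.
  have [u [_ Pu]] := sup_adherent e0 hS; rewrite opprB addrC subrK => su.
  by apply: Pu; rewrite s0 ltW.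
have [e e0 He] := step _ sup01 below.
suff : sup S = 1.
  move=> s1; have [->|tn1] := eqVneq t0 1.
    by apply: He; rewrite ?s1 ?lexx// ltrDl.
  by apply: below; rewrite t00 s1 lt_neqAle tn1.
apply/eqP; rewrite eq_le; case/andP: (sup01) => s0 -> /=; rewrite leNgt; apply/negP => s1.
have : S (Num.min 1 (sup S + e / 2)).
  split; first by rewrite le_min ler01 ge_min lexx /= addr_ge0// divr_ge0// ltW.
  move=> s /andP[s0']; rewrite le_min => /andP[s1' se].
  have [ss|ss] := ltP s (sup S); first by apply: below; rewrite s0' ss.
  by apply: He => //; rewrite ss (le_lt_trans se)// ltrD2l ltr_pdivrMr// ltr_pMr// ltr1n.
move=> /ub_le_sup => /(_ (ex_intro _ 1 S1)); rewrite leNgt; case/negP.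
by rewrite lt_min s1 ltrDl divr_gt0.
Qed.

(** Connectedness of the unit interval, in the form that propagates a property along a path: staying
    in a sheet, staying near the start, having a lift in the component. *)
Lemma locally_constant_itv (R : realType) (P : R -> Prop) :
  P 0 ->
  (forall t, 0 <= t <= 1 -> exists2 eta, 0 < eta &
     forall s, 0 <= s <= 1 -> `|s - t| < eta -> P s <-> P t) ->
  forall t, 0 <= t <= 1 -> P t.
Proof.
move=> P0 loc; apply: real_induction => t t01 Pt.
have [e e0 He] := loc _ t01; case/andP: (t01) => t0 t1.
suff Ptt : P t.
  exists e => // s /andP[ts se] s1.
  apply/(He s) => //; first by rewrite s1 (le_trans t0 ts).
  by rewrite ger0_norm ?subr_ge0// ltrBlDl.
have [->//|tn0] := eqVneq t 0.
have {tn0}t0' : 0 < t by rewrite lt_neqAle eq_sym tn0.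
pose s := Num.max 0 (t - e / 2).
have st : s < t by rewrite /s gt_max t0' ltrBlDr ltrDl divr_gt0.
have s0 : 0 <= s by rewrite /s le_max lexx.
apply/(He s); last by apply: Pt; rewrite s0.
  by rewrite s0 (le_trans (ltW st) t1).
rewrite ltr0_norm ?subr_lt0// opprB ltrBlDr -ltrBlDl.
by rewrite (@lt_le_trans _ _ (t - e / 2)) ?le_max ?lexx ?orbT// ltrD2l ltrN2 ltr_pdivrMr// ltr_pMr// ltr1n.
Qed.

Section RectifiableCurves.
Variables (R : realType) (T : metricType R).
Implicit Types (g : R -> T) (l : R -> R).

(** A real function playing the role of arc length. Unlike the supremum over partitions, it
    restricts to subintervals and concatenates without computation. *)
Definition dominates l g :=
  forall s t, 0 <= s -> s <= t -> t <= 1 -> mdist (g s) (g t) <= l t - l s.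

Lemma dominates_curve_length l g : dominates l g ->
  (curve_length g <= (l 1 - l 0)%:E)%E.
Proof.
move=> lg; apply: ge_ereal_sup => _ [s [ps /eqP ls] <-]; rewrite lee_fin.
have : forall a, 0 <= a -> path <%R a s -> last a s = 1 ->
    \sum_(0 <= k < size s) mdist (g (nth 1 (a :: s) k)) (g (nth 1 (a :: s) k.+1))
      <= l 1 - l a.
  elim: s {ps ls} => [|b s IH] a a0 /= => [_ ->|/andP[ab ps] ls].
    by rewrite big_geq// subrr.
  have b0 : 0 <= b by rewrite (le_trans a0)// ltW.
  rewrite big_nat_recl//= -[leRHS](subrKA (l b)) [leRHS]addrC lerD//; last exact: IH.
  apply: lg => //; first exact: ltW.
  rewrite -ls; elim: s b {IH ab ls b0} ps => //= c s IH b /andP[bc /IH].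
  exact/le_trans/ltW.
by apply; rewrite ?lexx.
Qed.

Let plen g (a : R) (s : seq R) :=
  \sum_(0 <= k < size s) mdist (g (nth 1 (a :: s) k)) (g (nth 1 (a :: s) k.+1)).

Let plen_rcons g a s b :
  plen g a (rcons s b) = plen g a s + mdist (g (last a s)) (g b).
Proof.
elim: s a => [|c s IH] a; first by rewrite /plen /= big_nat1 big_geq// add0r.
by rewrite /plen /= !big_nat_recl//= -addrA; congr (_ + _); exact: IH.
Qed.

(** The witness is the arc length function: the supremum of the lengths of the polygons inscribed in
    [g] over the interval from [0] to [t]. *)
Lemma curve_length_dominates g L : (curve_length g <= L%:E)%E ->
  exists2 l, dominates l g & l 1 - l 0 <= L.
Proof.
move=> gL.
pose S t := [set plen g 0 s | s in itv_partition 0 t].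
have bnd1 s : itv_partition 0 1 s -> plen g 0 s <= L.
  move=> ps; rewrite -lee_fin (le_trans _ gL)//.
  by apply: ereal_sup_ubound; exists s.
have bnd t : t <= 1 -> ubound (S t) L.
  move=> t1 _ [s [ps /eqP ls] <-].
  have [te1|tn1] := eqVneq t 1.
    by apply: bnd1; split => //; rewrite ls te1.
  (* A polygon ending before [1] is completed by the vertex [1], which can only lengthen it. *)
  apply: le_trans (bnd1 (rcons s 1) _); first by rewrite plen_rcons lerDl mdist_ge0.
  split; last by rewrite last_rcons.
  by rewrite rcons_path ps ls lt_neqAle tn1.
have ne t : 0 <= t -> S t !=set0.
  move=> t0; have [te0|tn0] :=
      eqVneq t 0; first by exists (plen g 0 [::]); exists [::]; rewrite ?te0//.
  by exists (plen g 0 [:: t]); exists [:: t] => //; split; rewrite /= ?andbT// lt_neqAle eq_sym tn0.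
exists (fun t => sup (S t)); last first.
  rewrite lerBlDr (@le_trans _ _ L)//.
    by apply: ge_sup; [exact: ne|exact: bnd].
  rewrite lerDl; apply: ub_le_sup; first by exists L; exact: bnd.
  by exists [::] => //; rewrite /plen big_geq.
move=> s t s0 st t1.
have t0 : 0 <= t by exact: le_trans st.
have [->|nst] := eqVneq s t; first by rewrite subrr mdistxx.
rewrite lerBrDl -lerBrDr; apply: ge_sup; first exact: ne.
move=> _ [r [pr /eqP lr] <-]; rewrite lerBrDr.
apply: ub_le_sup; first by exists L; exact: bnd.
exists (rcons r t); last by rewrite plen_rcons lr.
split; last by rewrite last_rcons.
by rewrite rcons_path pr lr lt_neqAle nst.
Qed.

Lemma within_itvP g : {within `[0, 1], continuous g} <->
  (forall t, 0 <= t <= 1 -> forall e, 0 < e -> exists2 eta, 0 < eta &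
     forall s, 0 <= s <= 1 -> `|s - t| < eta -> mdist (g t) (g s) < e).
Proof.
split=> [/subspace_continuousP gc t t01 e e0|gc].
  have t01' : `[0, 1]%classic t by rewrite /= in_itv.
  have /metricType_numDomainType.cvgrPdist_lt/(_ _ e0) := gc _ t01'.
  rewrite near_withinE => /nbhs_ballP[eta eta0 H]; exists eta => // s s01 st.
  by apply: H; rewrite ?/ball /= ?in_itv//= distrC.
apply/subspace_continuousP => t; rewrite /= in_itv /= => t01.
apply/metricType_numDomainType.cvgrPdist_lt => e e0.
have [eta eta0 H] := gc _ t01 _ e0.
rewrite near_withinE; apply/nbhs_ballP; exists eta => // s.
by rewrite /ball /= distrC => ts; rewrite in_itv /= => s01; exact: H.
Qed.

End RectifiableCurves.

Lemma within_itv_realP (R : realType) (f : R -> R) :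
  (forall t, 0 <= t <= 1 -> forall e, 0 < e -> exists2 eta, 0 < eta &
     forall s, 0 <= s <= 1 -> `|s - t| < eta -> `|f t - f s| < e) ->
  {within `[0, 1], continuous f}.
Proof.
move=> fc; apply/(@within_itvP R R^o) => t t01 e e0.
have [eta eta0 H] := fc t t01 e e0; exists eta => // s s01 st.
by rewrite /mdist /= distrC H.
Qed.

(** An approximate form of the existence of geodesics. The error [e] makes it available in spaces
    not known to be complete, such as the covers. *)
Definition interpolable (R : realType) (T : metricType R) :=
  forall (x y : T) s e, 0 <= s <= mdist x y -> 0 < e ->
  exists2 z, mdist x z = s & mdist z y <= mdist x y - s + e.

Lemma mdist_diff (R : realType) (T : metricType R) (x y z : T) :
  `|mdist x y - mdist x z| <= mdist y z.
Proof.
rewrite ler_norml lerBlDr lerNl opprB lerBlDr; apply/andP; split.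
  by rewrite addrC; exact: metric_triangle.
by rewrite addrC (metric_sym y); exact: metric_triangle.
Qed.

Section AffineReparametrization.
Variables (R : realType) (a b : R).
Hypothesis (a0 : 0 <= a) (ab : a <= b) (b1 : b <= 1).

Definition aff (u : R) := a + (b - a) * u.

Lemma aff0 : aff 0 = a. Proof. by rewrite /aff mulr0 addr0. Qed.
Lemma aff1 : aff 1 = b. Proof. by rewrite /aff mulr1 addrC subrK. Qed.

Lemma aff01 (u : R) : 0 <= u <= 1 -> 0 <= aff u <= 1.
Proof.
move=> /andP[u0 u1]; have ab' : 0 <= b - a by rewrite subr_ge0.
rewrite /aff addr_ge0 ?mulr_ge0//= (le_trans _ b1)// -lerBrDl.
exact: ler_piMr.
Qed.

Lemma aff_mono (s t : R) : s <= t -> aff s <= aff t.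
Proof. by move=> st; rewrite /aff lerD2l ler_wpM2l// subr_ge0. Qed.

Lemma aff_dist (s t : R) : `|aff s - aff t| <= `|s - t|.
Proof.
rewrite /aff opprD addrACA subrr add0r -mulrBr normrM ger0_norm ?subr_ge0//.
by rewrite ler_piMl// lerBlDr (le_trans b1)// lerDl.
Qed.

Lemma dominates_aff (T : metricType R) l (g : R -> T) :
  dominates l g -> dominates (l \o aff) (g \o aff).
Proof.
move=> lg s t s0 st t1; apply: lg; last 1 first.
- by have /aff01/andP[] : 0 <= t <= 1 by rewrite t1 (le_trans s0).
- by have /aff01/andP[] : 0 <= s <= 1 by rewrite s0 (le_trans st).
- exact: aff_mono.
Qed.

Lemma within_aff (T : metricType R) (g : R -> T) :
  {within `[0, 1], continuous g} -> {within `[0, 1], continuous (g \o aff)}.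
Proof.
move=> /within_itvP gc; apply/within_itvP => t t01 e e0.
have [eta eta0 H] := gc _ (aff01 t01) _ e0; exists eta => // s s01 st.
by apply: H; [exact: aff01|exact: le_lt_trans (aff_dist _ _) st].
Qed.

End AffineReparametrization.

(** * Length metrics along a map, in terms of dominating functions *)

Section LiftedLengthMetric.
Variables (R : realType) (E T : metricType R) (pi : E -> T).

Lemma lifted_length_metricI :
  (forall x y g l, is_path x y g -> dominates l (pi \o g) ->
     mdist x y <= l 1 - l 0) ->
  (forall x y e, 0 < e -> exists g l,
     [/\ is_path x y g, dominates l (pi \o g) & l 1 - l 0 <= mdist x y + e]) ->
  lifted_length_metric pi.
Proof.
move=> H1 H2 x y; apply/eqP; rewrite eq_le; apply/andP; split.
  apply: le_ereal_inf_tmp => _ [g xyg <-].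
  case E0 : (curve_length (pi \o g)) => [L||]; last 2 first.
  - by rewrite leey.
  (* The one-segment polygon shows that a length is never [-oo]. *)
  - have : (0%:E <= curve_length (pi \o g))%E; last by rewrite E0.
    apply: ereal_sup_ge; exists (mdist (pi (g 0)) (pi (g 1)))%:E; last first.
      by rewrite lee_fin mdist_ge0.
    exists [:: 1]; first by split; rewrite /= ?ltr01.
    by rewrite /= big_nat1.
  have [l lg lL] :=
      @curve_length_dominates _ _ (pi \o g) L (eq_ind_r (fun z => z <= _)%E (lexx _) E0).
  by rewrite lee_fin (le_trans _ lL)//; exact: H1 lg.
apply/lee_addgt0Pr => e e0; have [g [l [xyg lg lL]]] := H2 x y e e0.
rewrite (@le_trans _ _ (l 1 - l 0)%:E) ?lee_fin//.
rewrite (le_trans _ (dominates_curve_length lg))//.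
by apply: ereal_inf_lbound; exists g.
Qed.

Hypothesis lifted : lifted_length_metric pi.

Lemma lifted_mdist_le x y g l : is_path x y g -> dominates l (pi \o g) ->
  mdist x y <= l 1 - l 0.
Proof.
move=> xyg lg; rewrite -lee_fin lifted.
rewrite (le_trans _ (dominates_curve_length lg))//.
by apply: ereal_inf_lbound; exists g.
Qed.

Lemma lifted_approx x y L : mdist x y < L -> exists g l,
  [/\ is_path x y g, dominates l (pi \o g) & l 1 - l 0 < L].
Proof.
rewrite -lte_fin lifted => /ereal_inf_lt[_ [g xyg <-] gL].
case E0 : (curve_length (pi \o g)) gL => [K||] KL; last 2 first.
- by rewrite ltNge leey in KL.
- have [l lg lK] :=
    @curve_length_dominates _ _ (pi \o g) (L - 1) (eq_ind_r (fun z => z <= _)%E (leNye _) E0).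
  by exists g, l; split => //; rewrite (le_lt_trans lK)// ltrBlDr ltrDl.
have [l lg lK] :=
    @curve_length_dominates _ _ (pi \o g) K (eq_ind_r (fun z => z <= _)%E (lexx _) E0).
by exists g, l; split => //; exact: le_lt_trans lK KL.
Qed.

Lemma lifted_lipschitz x y : mdist (pi x) (pi y) <= mdist x y.
Proof.
apply/ler_addgt0Pl => e e0.
have [|g [l [[_ <- <-] lg lL]]] := @lifted_approx x y (e + mdist x y).
  by rewrite ltrDr.
by rewrite (le_trans _ (ltW lL))//; exact: lg.
Qed.

(** An almost minimal path from [x] to [y] is cut where its distance from [x] equals [s], by the
    intermediate value theorem. Both pieces bound the distance of their ends, and their lengths add
    up to less than [mdist x y + e]. *)
Lemma lifted_interpolable : interpolable E.
Proof.
move=> x y s e /andP[s0 sxy] e0.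
have [|g [l [[gc g0 g1] lg lL]]] := @lifted_approx x y (mdist x y + e).
  by rewrite ltrDl.
have fc : {within `[0, 1], continuous (fun t => mdist x (g t))}.
  apply: within_itv_realP => t t01 e' e'0.
  have [eta eta0 H] := (iffLR (within_itvP g) gc) t t01 _ e'0.
  exists eta => // u u01 ut; apply: le_lt_trans (mdist_diff _ _ _) _; exact: H.
have [|t] := @IVT R _ 0 1 s ler01 fc.
  by rewrite g0 g1 mdistxx ge_min s0 le_max sxy orbT.
rewrite in_itv /= => t01 ts; case/andP: (t01) => t0 t1.
exists (g t) => //.
have xt : mdist x (g t) <= l t - l 0.
  rewrite -(aff1 0 t) -[X in _ - l X](aff0 0 t).
  apply: (lifted_mdist_le (g := g \o aff 0 t) _ (dominates_aff _ _ _ lg)) => //.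
  split; rewrite /= ?aff0 ?aff1 ?g0//; exact: within_aff.
have ty : mdist (g t) y <= l 1 - l t.
  rewrite -[X in l X - _](aff1 t 1) -[X in _ - l X](aff0 t 1).
  apply: (lifted_mdist_le (g := g \o aff t 1) _ (dominates_aff _ _ _ lg)) => //.
  split; rewrite /= ?aff0 ?aff1 ?g1//; exact: within_aff.
by rewrite -ts; lra.
Qed.

End LiftedLengthMetric.

(** * Proper geodesic spaces *)

Section MetricCompactness.
Variables (R : realType) (T : metricType R).
Implicit Types (K : set T).

Definition is_net (e : R) (s : seq T) K :=
  forall x, K x -> exists2 z, z \in s & mdist z x < e.

(** If no finite subset of [K] is a net, the sets of points of [K] at distance at least [e] from a
    finite subset form a base of a proper filter. A cluster point [x] would have its [e]-ball meet
    [B [:: x]], which is impossible. *)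
Lemma compact_net K (e : R) : compact K -> 0 < e ->
  exists2 s : seq T, (forall z : T, z \in s -> K z) & is_net e s K.
Proof.
move=> cK e0; apply: contrapT => noS.
pose D : set (seq T) := [set s : seq T | forall z : T, z \in s -> K z].
pose B (s : seq T) : set T := [set x | K x /\ forall z, z \in s -> e <= mdist z x].
have FF : ProperFilter (filter_from D B).
  apply: filter_from_proper; last first.
    move=> s Ds; apply: contrapT => Bs; apply: noS; exists s => // x Kx.
    apply: contrapT => xs; apply: Bs; exists x; split => // z zs.
    by rewrite leNgt; apply/negP => zx; apply: xs; exists z.
  apply: filter_from_filter; first by exists [::].
  move=> s s' Ds Ds'; exists (s ++ s').
    by move=> z; rewrite mem_cat => /orP[/Ds|/Ds'].
  move=> x [Kx xs].
  by split; split => // z zs; apply: xs; rewrite mem_cat zs ?orbT.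
have [x [Kx clx]] : K `&` cluster (filter_from D B) !=set0.
  by apply: cK; exists [::] => // x [].
have [||y [[_ /(_ x)]]] := clx (B [:: x]) (ball x e).
- by exists [:: x] => // z; rewrite inE => /eqP ->.
- exact: nbhsx_ballx.
by rewrite ballEmdist inE eqxx leNgt => /(_ isT) /negP.
Qed.

(** An ultrafilter on [K] is Cauchy: if it contained no [e]-ball, it would contain the complements
    of the finitely many balls around a net, whose intersection misses [K]. *)
Lemma totally_bounded_compact K : complete_space T -> closed K ->
  (forall e : R, 0 < e -> exists s, is_net e s K) -> compact K.
Proof.
move=> cT clK netK; rewrite compact_ultra => F UF FK.
have [|x Fx] := cT F _; last first.
  exists x; split => //; exact: (@closed_cvg _ _ F _ id K clK FK x Fx).
apply: cauchy_exP => e e0; have [s sK] := netK e e0.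
apply: contrapT => /forallNP nF.
have : F [set x | forall z, z \in s -> e <= mdist z x].
  elim: s {sK} => [|a s IH].
    by apply: filterS FK.
  have [/nF//|Fa] := in_ultra_setVsetC (ball a e) UF.
  apply: filterS2 Fa IH => x; rewrite ballEmdist => /negP ax xs z.
  by rewrite inE => /orP[/eqP->|/xs//]; rewrite leNgt.
move=> /(filterI FK)/filter_ex[x [/sK[z zs zx] /(_ z zs)]].
by rewrite leNgt zx.
Qed.

(** With [U] fixed beforehand, limits of arbitrarily many sequences exist simultaneously; this
    replaces the extraction of diagonal subsequences. *)
Lemma compact_ultra_lim K (U : set_system nat) (u : nat -> T) :
  UltraFilter U -> compact K -> (forall n, K (u n)) ->
  exists2 x, K x & forall e : R, 0 < e -> U [set n | mdist x (u n) < e].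
Proof.
move=> UU cK uK.
have [|x [Kx clx]] := cK (u @ U) _; first by rewrite /nbhs /=; apply: filterE.
exists x => // e e0.
have [//|nU] := in_ultra_setVsetC [set n | mdist x (u n) < e] UU.
have [|y [/= yx /yx//]] := clx (~` ball x e) (ball x e) _ (nbhsx_ballx _ _ e0).
by rewrite /nbhs /=; apply: filterS nU => n /=; rewrite ballEmdist.
Qed.

Lemma mclosed_ball_closed (x : T) (r : R) : closed (mclosed_ball x r).
Proof.
move=> y cly; rewrite /mclosed_ball /= leNgt; apply/negP => ry.
have e0 : 0 < mdist x y - r by rewrite subr_gt0.
have [z [/=]] := cly _ (nbhsx_ballx y _ e0).
rewrite /mclosed_ball ballEmdist /= => xz yz.
have := metric_triangle x z y; rewrite (metric_sym z) leNgt => /negP; apply.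
lra.
Qed.

Definition proper_space := forall (x : T) (r : R), compact (mclosed_ball x r).

Definition geodesic_space := forall x y : T, exists g : R -> T,
  [/\ g 0 = x, g 1 = y & forall s t, 0 <= s <= 1 -> 0 <= t <= 1 ->
        mdist (g s) (g t) <= `|s - t| * mdist x y].

Hypothesis interp : interpolable T.

Lemma interp_closer (x y : T) (r e : R) : 0 <= r -> 0 < e -> mdist x y <= r + e ->
  exists2 z, mdist x z <= r & mdist z y < 2 * e.
Proof.
move=> r0 e0 xyr; have [xy|xy] := leP (mdist x y) r.
  by exists y => //; rewrite mdistxx mulr_gt0.
have [|z xz zy] :=
    interp (x := x) (y := y) (s := r) (e := e / 2) _ (divr_gt0 e0 (ltr0Sn R 1)).
  by rewrite r0 ltW.
by exists z; rewrite ?xz//; lra.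
Qed.

(** Real induction on the fraction [t] of the radius. Compactness passes to the limit radius because
    a net of a slightly smaller ball is a coarser net of the larger one, and then beyond it because
    finitely many compact balls of uniform radius cover a slightly larger ball. *)
Lemma hopf_rinow : complete_space T ->
  (forall x : T, exists2 r : R, 0 < r & compact (mclosed_ball x r)) ->
  proper_space.
Proof.
move=> cT lc x r; have [r0|r0] := ltP r 0.
  rewrite (_ : mclosed_ball x r = set0); first exact: compact0.
  apply/seteqP; split => // y; rewrite /mclosed_ball /= => xy.
  by have := le_lt_trans xy r0; rewrite ltNge mdist_ge0.
suff /(_ 1) : forall t : R, 0 <= t <= 1 -> compact (mclosed_ball x (t * r)).
  by rewrite mul1r; apply; rewrite ler01 lexx.
apply: real_induction => t /andP[t0 t1] ct.
have cpt : compact (mclosed_ball x (t * r)).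
  (* For [r = 0] the radius cannot be shrunk: compactness comes from the local hypothesis at
     [t = 0], and from the induction hypothesis at [0] otherwise. *)
  have [rE|rn0] := eqVneq r 0.
    have [te|tn0] := eqVneq t 0.
      have [e e0 ce] := lc x.
      apply: subclosed_compact ce _; first exact: mclosed_ball_closed.
      by move=> y; rewrite /mclosed_ball /= rE mulr0 => /le_trans; apply; exact: ltW.
    have := ct 0; rewrite rE !mulr0; apply.
    by rewrite lexx lt_neqAle eq_sym tn0.
  have {rn0}rp : 0 < r by rewrite lt_neqAle eq_sym rn0.
  apply: totally_bounded_compact => //; first exact: mclosed_ball_closed.
  move=> e e0.
  have [te|te] := leP (t * r) (e / 2).
    exists [:: x] => y xy; exists x; rewrite ?inE//.
    by rewrite (le_lt_trans xy)// (le_lt_trans te)// ltr_pdivrMr// ltr_pMr// ltr1n.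
  (* The radius [s * r] is [t * r - e / 4]: interpolation brings a point into that ball at a cost
     below [e / 2], and the net adds less than [e / 2]. *)
  pose s := t - (e / 4) / r.
  have sr : s * r = t * r - e / 4 by rewrite /s mulrBl divfK// gt_eqF.
  have s0 : 0 <= s by rewrite -(pmulr_lge0 _ rp) sr; lra.
  have st : s < t by rewrite /s ltrBlDr ltrDl !divr_gt0.
  have e2 : 0 < e / 2 by rewrite divr_gt0.
  have [|l _ lnet] := compact_net (ct s _) e2; first by rewrite s0.
  exists l => y xy.
  have e4 : 0 < e / 4 by rewrite divr_gt0.
  have [||z xz zy] := @interp_closer x y (s * r) (e / 4) _ e4.
  - by rewrite mulr_ge0.
  - by rewrite sr subrK.
  have [w wl wz] := lnet z xz; exists w => //.
  by rewrite (le_lt_trans (metric_triangle _ z _))//; lra.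
(* Compactness of the ball makes the radius of local compactness uniform on it. *)
have [d d0 Hd] : exists2 d : R, 0 < d &
    forall y, mclosed_ball x (t * r) y -> compact (mclosed_ball y d).
  have := iffLR (compact_near_coveringP _) cpt R (0^'+)
    (fun d y => compact (mclosed_ball y d)) _ _.
  case=> [y _|e /= e0 He].
    have [e e0 ce] := lc y.
    exists (ball y (e / 2), [set d | d < e / 2]) => /=.
      split; first by apply: nbhsx_ballx; rewrite divr_gt0.
      by apply: nbhs_right_lt; rewrite divr_gt0.
    move=> [z d] /= []; rewrite ballEmdist /= => yz de.
    apply: subclosed_compact ce _; first exact: mclosed_ball_closed.
    move=> w; rewrite /mclosed_ball /= => zw.
    by rewrite (le_trans (metric_triangle _ z _))//; lra.
  exists (e / 2); first by rewrite divr_gt0.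
  apply: He; rewrite /= ?divr_gt0// sub0r normrN gtr0_norm ?divr_gt0//.
  by rewrite ltr_pdivrMr// ltr_pMr// ltr1n.
have d4 : 0 < d / 4 by rewrite divr_gt0.
have [l lK lnet] := compact_net cpt d4.
have cl : compact (\big[setU/set0]_(z <- l) mclosed_ball z d).
  by rewrite big_seq; apply: bigsetU_compact => z /lK; exact: Hd.
have [e e0 He] : exists2 e : R, 0 < e & forall y, mdist x y <= t * r + e ->
    exists2 z, mclosed_ball x (t * r) z & mdist z y < d / 2.
  exists (d / 4) => // y xy.
  have [|z xz zy] := interp_closer _ d4 xy; first by rewrite mulr_ge0.
  by exists z => //; lra.
(* The denominator [r + 1] is positive even for [r = 0], and the choice gives
   [s * r <= t * r + e]. *)
exists (e / (r + 1)); first by rewrite divr_gt0// ltr_wpDl.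
move=> s /andP[ts se] s1.
have ser : s * r <= t * r + e.
  have r1 : 0 < r + 1 by rewrite ltr_wpDl.
  rewrite -lerBlDl -mulrBl (@le_trans _ _ (e / (r + 1) * (r + 1)))//.
    by rewrite ler_pM ?subr_ge0//; [rewrite lerBlDl ltW | rewrite lerDl].
  by rewrite divfK// gt_eqF.
apply: subclosed_compact cl _; first exact: mclosed_ball_closed.
move=> y xy; have [z /lnet[w wl wz] zy] := He y (le_trans xy ser).
rewrite -bigcup_seq; exists w => //; rewrite /mclosed_ball /=.
by rewrite (le_trans (metric_triangle _ z _))//; lra.
Qed.

(** * From approximate chains to minimal geodesics *)

Lemma interp_chain (x y : T) (n : nat) : exists z : nat -> T,
  [/\ z 0%N = x,
      forall k, mdist (z k) (z k.+1) <= mdist x y / n.+1%:R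
    & mdist (z n.+1) y <= n.+1%:R^-1].
Proof.
set D := mdist x y; set h := D / _; pose N : R := n.+1%:R.
have N0 : 0 < N by rewrite ltr0n.
have h0 : 0 <= h by rewrite divr_ge0 ?mdist_ge0// ltW.
(* There are [N] steps, each missing by at most [e], so the total defect is at most [N^-1]. *)
pose e := N^-1 / N; have e0 : 0 < e by rewrite divr_gt0 ?invr_gt0.
have step w : exists w', mdist w w' <= h /\
    mdist w' y <= Num.max 0 (mdist w y - h) + e.
  have [wh|hw] := leP (mdist w y) h.
    by exists y; split => //; rewrite mdistxx addr_ge0 ?(ltW e0)// le_max lexx.
  have [|w' ww' w'y] := interp (x := w) (y := y) (s := h) _ e0.
    by rewrite h0 ltW.
  exists w'; split; first by rewrite ww'.
  by rewrite (le_trans w'y)// lerD2r le_max lexx orbT.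
have [F HF] := choice step.
exists (fun k => iter k F x); split => //.
  by move=> k; rewrite iterS; have [] := HF (iter k F x).
suff H k : mdist (iter k F x) y <= Num.max 0 (D - k%:R * h) + k%:R * e.
  rewrite (le_trans (H _))// /h mulrC divfK ?gt_eqF// subrr maxxx add0r.
  by rewrite /e mulrC divfK// gt_eqF.
elim: k => [|k IH]; first by rewrite !mul0r subr0 addr0 le_max lexx orbT.
rewrite iterS; have [_ /le_trans] := HF (iter k F x); apply.
rewrite -natr1 !mulrDl !mul1r addrA lerD2r ge_max; apply/andP; split.
  by rewrite addr_ge0 ?le_max ?lexx// mulr_ge0// ltW.
have k0 : 0 <= k%:R * e by rewrite mulr_ge0// ltW.
rewrite lerBlDr (le_trans IH)// [leRHS]addrAC lerD2r ge_max.
apply/andP; split; first by rewrite addr_ge0// le_max lexx.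
by rewrite -lerBlDr le_max; apply/orP; right; lra.
Qed.

Lemma dist_truncn (n : nat) (s t : R) : 0 <= s -> 0 <= t ->
  `|(Num.truncn (s * n%:R))%:R - (Num.truncn (t * n%:R))%:R| <= `|s - t| * n%:R + 1.
Proof.
move=> s0 t0.
have H (u : R) : 0 <= u ->
    (Num.truncn (u * n%:R))%:R <= u * n%:R < (Num.truncn (u * n%:R))%:R + 1.
  by move=> u0; rewrite natr1 truncn_itv// mulr_ge0.
have /andP[s1 s2] := H _ s0; have /andP[t1 t2] := H _ t0.
have -> : `|s - t| * n%:R = `|s * n%:R - t * n%:R|.
  by rewrite -mulrBl normrM (ger0_norm (ler0n _ n)).
set a := s * _ in s1 s2 *; set b := t * _ in t1 t2 *.
have ab1 : a - b <= `|a - b| by exact: ler_norm.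
have ab2 : b - a <= `|a - b| by rewrite distrC; exact: ler_norm.
by rewrite ler_norml; apply/andP; split; lra.
Qed.

(** The chains of [interp_chain], read as step functions of the parameter, are Lipschitz up to an
    error [D / n.+1%:R]. Their pointwise limit along a nonprincipal ultrafilter is Lipschitz with
    constant [D]. *)
Lemma proper_geodesic : proper_space -> geodesic_space.
Proof.
move=> pT x y; pose D := mdist x y.
have D0 : 0 <= D by exact: mdist_ge0.
have [U [UU infU]] := ultraFilterLemma eventually_filter.
have [Z HZ] := choice (interp_chain x y).
have ZL n j k : mdist (Z n j) (Z n (j + k)%N) <= k%:R * (D / n.+1%:R).
  elim: k => [|k IH]; first by rewrite addn0 mdistxx mul0r.
  rewrite addnS (le_trans (metric_triangle _ (Z n (j + k)%N) _))//.
  by rewrite -natr1 mulrDl mul1r lerD//; have [_ ->] := HZ n.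
have ZL' n j k : mdist (Z n j) (Z n k) <= `|j%:R - k%:R| * (D / n.+1%:R).
  wlog jk : j k / (j <= k)%N.
    by move=> W; have [/W//|/ltnW/W] := leqP j k; rewrite metric_sym distrC.
  by rewrite distrC -natrB// ger0_norm// -{1}(subnKC jk).
pose G n (s : R) := Z n (Num.truncn (s * n.+1%:R)).
have GL n (s t : R) : 0 <= s -> 0 <= t ->
    mdist (G n s) (G n t) <= `|s - t| * D + D / n.+1%:R.
  move=> s0 t0; rewrite (le_trans (ZL' _ _ _))//.
  have N0 : 0 < n.+1%:R :> R by rewrite ltr0n.
  rewrite (@le_trans _ _ ((`|s - t| * n.+1%:R + 1) * (D / n.+1%:R)))//.
    by rewrite ler_wpM2r ?dist_truncn// divr_ge0// ltW.
  by rewrite mulrDl mul1r lerD2r -mulrA [_ * (D / _)]mulrC divfK ?gt_eqF.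
have G0 n : G n 0 = x by rewrite /G mul0r truncn0; have [] := HZ n.
have lim (s : R) : exists z, 0 <= s <= 1 ->
    forall e : R, 0 < e -> U [set n | mdist z (G n s) < e].
  have [s01|s01] := pselect (0 <= s <= 1); last by exists x.
  have [|z _ Hz] := compact_ultra_lim UU (pT x (D + D)) (u := G^~ s); last by exists z.
  move=> n; rewrite /mclosed_ball /= -[X in mdist X](G0 n).
  case/andP: s01 => s0 s1.
  rewrite (le_trans (GL _ _ _ _ _))// lerD//.
    by rewrite sub0r normrN ger0_norm// ler_piMl.
  by rewrite ler_pdivrMr// ler_peMr// ler1n.
have [g Hg] := choice lim.
have I0 : 0 <= (0 : R) <= 1 by rewrite lexx ler01.
have I1 : 0 <= (1 : R) <= 1 by rewrite lexx ler01.
(* This quantity bounds both the Lipschitz error and the distance of the end of the chain from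
   [y]. *)
have small (e : R) : 0 < e -> U [set n | n.+1%:R^-1 * (D + 1) < e].
  move=> e0; apply: infU; near=> n.
  rewrite /= mulrC ltr_pdivrMr// -ltr_pdivrMl//.
  rewrite (lt_trans (y := n%:R)) ?ltr_nat//.
  by near: n; exact: nbhs_infty_gtr.
have gL (s t : R) : 0 <= s <= 1 -> 0 <= t <= 1 -> mdist (g s) (g t) <= `|s - t| * D.
  move=> s01 t01; apply/ler_addgt0Pl => e e0.
  have e3 : 0 < e / 3 by rewrite divr_gt0.
  have [n [[/= n1 n2] n3]] :=
      filter_ex (filterI (filterI (Hg s s01 _ e3) (Hg t t01 _ e3)) (small _ e3)).
  have := GL n s t; case/andP: s01 => -> _; case/andP: t01 => -> _ /(_ isT isT) H.
  have tri1 := metric_triangle (g s) (G n s) (g t).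
  have tri2 := metric_triangle (G n s) (G n t) (g t).
  rewrite (metric_sym (G n t)) in tri2.
  have : D / n.+1%:R <= n.+1%:R^-1 * (D + 1).
    by rewrite mulrC ler_pM2l// lerDl.
  move: H n3; set a := D / _; set b := _ * (D + 1); set c := `|s - t| * D.
  by move=> H n3 ab; lra.
exists g; split => //.
- apply: mdist_positivity; apply/eqP; rewrite eq_le mdist_ge0 andbT.
  apply/ler_addgt0Pl => e e0.
  have [n /=] := filter_ex (Hg 0 I0 e e0).
  by rewrite G0 addr0 => /ltW.
- apply: mdist_positivity; apply/eqP; rewrite eq_le mdist_ge0 andbT.
  apply/ler_addgt0Pl => e e0; rewrite addr0.
  have e2 : 0 < e / 2 by rewrite divr_gt0.
  have [n [/= n1 n2]] := filter_ex (filterI (Hg 1 I1 _ e2) (small _ e2)).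
  have [_ _ n3] := HZ n.
  have tri := metric_triangle (g 1) (G n 1) y.
  have : n.+1%:R^-1 <= n.+1%:R^-1 * (D + 1).
    by rewrite ler_peMr// lerDr.
  move: n1 tri; rewrite /G mul1r natrK => n1 tri.
  move: n2 n3; set a := _^-1 * _; set b := n.+1%:R^-1.
  by move=> n2 n3 ba; lra.
Unshelve. all: by end_near. Qed.

End MetricCompactness.

(** * Joining points by paths *)

Section Paths.
Variables (R : realType) (S : Type) (T : metricType R) (q : S -> T).
Variables (rel : S -> S -> Prop) (A : set S).

(* Continuity of [q \o g], strengthened by requiring nearby points of [g] to be
   [rel]-related: [rel] tells the sheets of a covering apart. *)
Definition path_cont (g : R -> S) :=
  forall t, 0 <= t <= 1 -> forall e, 0 < e -> exists2 eta, 0 < eta &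
     forall s, 0 <= s <= 1 -> `|s - t| < eta ->
       mdist (q (g t)) (q (g s)) < e /\ rel (g t) (g s).

(** [S] is a bare type: it will be a product whose second coordinate is allowed to jump along [g],
    so continuity in the product topology would be too strong. *)
Definition joined (u v : S) (L : R) := exists (g : R -> S) (l : R -> R),
  [/\ g 0 = u /\ g 1 = v, forall t, 0 <= t <= 1 -> A (g t), path_cont g,
      dominates l (q \o g) & l 1 - l 0 <= L].

Lemma joined_le u v L L' : L <= L' -> joined u v L -> joined u v L'.
Proof.
by move=> LL [g [l [g01 gA gc lg lL]]]; exists g, l; split => //; exact: le_trans LL.
Qed.

Lemma joined_refl u : A u -> rel u u -> joined u u 0.
Proof.
move=> Au ru; exists (fun=> u), (fun=> 0); split => //.
- by move=> t _ e e0; exists 1 => // s _ _; rewrite mdistxx.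
- by move=> s t _ _ _; rewrite /= mdistxx subrr.
Qed.

Lemma joined_sym u v L : joined u v L -> joined v u L.
Proof.
move=> [g [l [[g0 g1] gA gc lg lL]]].
have rev01 (t : R) : 0 <= t <= 1 -> 0 <= 1 - t <= 1.
  by move=> /andP[t0 t1]; rewrite subr_ge0 t1 lerBlDr lerDl.
exists (fun t => g (1 - t)), (fun t => - l (1 - t)); split.
- by rewrite subr0 subrr.
- by move=> t /rev01; exact: gA.
- move=> t t01 e e0; have [eta eta0 H] := gc _ (rev01 _ t01) e e0.
  exists eta => // s /rev01 s01 st; apply: H => //.
  by rewrite opprD addrACA subrr add0r opprK addrC distrC.
- move=> s t s0 st t1 /=.
  rewrite opprK [leRHS]addrC metric_sym; apply: lg.
  + by rewrite subr_ge0.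
  + by rewrite lerD2l lerN2.
  + by rewrite lerBlDr lerDl.
- by rewrite opprK subrr subr0 addrC.
Qed.

Lemma joined_cat u v w L K : joined u v L -> joined v w K -> joined u w (L + K).
Proof.
move=> [g [l [[g0 g1] gA gc lg lL]]] [h [k [[h0 h1] hA hc kh kK]]].
have H1 (t : R) : 0 <= t <= 1 -> t <= 2^-1 -> 0 <= t * 2 <= 1.
  by move=> /andP[t0 t1] t2; apply/andP; split; lra.
have H2 (t : R) : 0 <= t <= 1 -> 2^-1 <= t -> 0 <= t * 2 - 1 <= 1.
  by move=> /andP[t0 t1] t2; apply/andP; split; lra.
exists (fun t => if t <= 2^-1 then g (t * 2) else h (t * 2 - 1)).
(* The shift makes the second dominating function start at the final value of the first. *)
exists (fun t => if t <= 2^-1 then l (t * 2) else k (t * 2 - 1) - k 0 + l 1).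
have nle : ((1 : R) <= 2^-1) = false by apply/negbTE; rewrite -ltNge; lra.
have ge0 : ((0 : R) <= 2^-1) by lra.
split.
- by rewrite ge0 nle !mul0r mul1r (_ : 2 - 1 = 1); last lra.
- move=> t t01; have [t2|t2] := leP t 2^-1; first exact/gA/H1.
  by apply/hA/H2 => //; exact: ltW.
- move=> t t01 e e0; have [t2|t2] := leP t 2^-1; last first.
    have [eta eta0 H] := hc _ (H2 _ t01 (ltW t2)) _ e0.
    exists (Num.min (eta / 2) (t - 2^-1)); first by rewrite lt_min divr_gt0//= subr_gt0.
    move=> s s01; rewrite lt_min => /andP[st1 st2].
    have [s2|s2] := leP s 2^-1.
      by move: st2; rewrite ltr_norml => /andP[]; lra.
    apply: H; first exact: H2 (ltW s2).
    by rewrite opprB addrA subrK -mulrBl normrM (@ger0_norm _ 2)// -ltr_pdivlMr.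
  have [eta eta0 H] := gc _ (H1 _ t01 t2) _ e0.
  (* At the seam both halves are close by, hence the smaller of the two moduli. *)
  have [te|tn] := eqVneq t 2^-1.
    have [|eta' eta'0 H'] := hc 0 _ _ e0; first by rewrite lexx ler01.
    exists (Num.min (eta / 2) (eta' / 2)); first by rewrite lt_min !divr_gt0.
    move=> s s01; rewrite lt_min => /andP[st1 st2].
    have t21 : t * 2 = 1 by rewrite te mulVf.
    have [s2|s2] := leP s 2^-1.
      apply: H; first exact: H1.
      by rewrite -mulrBl normrM (@ger0_norm _ 2)// -ltr_pdivlMr.
    rewrite t21 g1 -h0; apply: H'; first exact: H2 (ltW s2).
    by rewrite subr0 -[X in _ - X]t21 -mulrBl normrM (@ger0_norm _ 2)// -ltr_pdivlMr.
  exists (Num.min (eta / 2) (2^-1 - t)).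
    by rewrite lt_min divr_gt0//= subr_gt0 lt_neqAle tn.
  move=> s s01; rewrite lt_min => /andP[st1 st2].
  have [s2|s2] := leP s 2^-1; last first.
    by move: st2; rewrite ltr_norml => /andP[]; lra.
  apply: H; first exact: H1.
  by rewrite -mulrBl normrM (@ger0_norm _ 2)// -ltr_pdivlMr.
- move=> s t s0 st t1 /=.
  have t0 : 0 <= t by exact: le_trans st.
  have s1 : s <= 1 by exact: le_trans t1.
  have [t2|t2] := leP t 2^-1.
    rewrite (le_trans st t2); apply: lg; [lra|lra|lra].
  have [s2|s2] := leP s 2^-1; last first.
    rewrite opprD addrACA subrr addr0 opprD addrACA subrr addr0.
    by apply: kh; lra.
  rewrite (le_trans (metric_triangle _ (q v) _))//.
  have -> : k (t * 2 - 1) - k 0 + l 1 - l (s * 2) =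
    (l 1 - l (s * 2)) + (k (t * 2 - 1) - k 0) by ring.
  rewrite lerD//.
    by rewrite -g1; apply: lg; lra.
  by rewrite -h0; apply: kh; lra.
- rewrite ge0 nle mul0r mul1r (_ : 2 - 1 = 1); last by ring.
  by rewrite -addrA addrC lerD.
Qed.

Lemma joined_sub (g : R -> S) (l : R -> R) : (forall t, 0 <= t <= 1 -> A (g t)) ->
  path_cont g -> dominates l (q \o g) ->
  forall s t, 0 <= s -> s <= t -> t <= 1 -> joined (g s) (g t) (l t - l s).
Proof.
move=> gA gc lg s t s0 st t1.
exists (g \o aff s t), (l \o aff s t); split => /=.
- by rewrite aff0 aff1.
- by move=> u u01; exact/gA/aff01.
- move=> u u01 e e0; have [eta eta0 H] := gc _ (aff01 s0 st t1 u01) _ e0.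
  exists eta => // v v01 uv; apply: H; first exact: aff01.
  exact: le_lt_trans (aff_dist _ _ _ _ _) uv.
- by have := dominates_aff s0 st t1 lg.
- by rewrite aff0 aff1.
Qed.

Lemma joined_mdist u v L : joined u v L -> mdist (q u) (q v) <= L.
Proof.
move=> [g [l [[<- <-] _ _ lg lL]]]; apply: le_trans lL.
by apply: lg; rewrite ?lexx ?ler01.
Qed.

End Paths.

Definition joined_in (R : realType) (T : metricType R) (A : set T) :=
  joined (@id T) (fun _ _ => True) A.

(** Every point of a minimal geodesic satisfies the two inequalities on [z], so [A] contains it
    without the geodesic being named. *)
Lemma geodesic_joined (R : realType) (T : metricType R) (A : set T) (x y : T) :
  geodesic_space T ->
  (forall z, mdist x z <= mdist x y -> mdist z y <= mdist x y -> A z) ->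
  joined_in A x y (mdist x y).
Proof.
move=> gT xyA; have [g [g0 g1 gL]] := gT x y.
have I0 : 0 <= (0 : R) <= 1 by rewrite lexx ler01.
have I1 : 0 <= (1 : R) <= 1 by rewrite lexx ler01.
exists g, (fun t => t * mdist x y); split => //.
- move=> t t01; case/andP: (t01) => t0 t1; apply: xyA.
    rewrite -[X in mdist X _ <= _]g0 (le_trans (gL _ _ I0 t01))// sub0r normrN ger0_norm//.
    by rewrite ler_piMl// mdist_ge0.
  rewrite -[X in mdist _ X <= _]g1 (le_trans (gL _ _ t01 I1))//.
  rewrite distrC ger0_norm ?subr_ge0// ler_piMl ?mdist_ge0//.
  by rewrite lerBlDr lerDl.
- move=> t t01 e e0; exists (e / (mdist x y + 1)).
    by rewrite divr_gt0// ltr_wpDl// mdist_ge0.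
  move=> s s01 st; split => //=.
  rewrite (le_lt_trans (gL _ _ t01 s01))// distrC.
  have D0 : 0 < mdist x y + 1 by rewrite ltr_wpDl// mdist_ge0.
  rewrite ltr_pdivlMr// in st; rewrite (le_lt_trans _ st)//.
  by rewrite ler_wpM2l// lerDl.
- move=> s t s0 st t1; rewrite /= (le_trans (gL _ _ _ _))//.
  + by rewrite s0 (le_trans st).
  + by rewrite t1 (le_trans s0).
  + by rewrite distrC ger0_norm ?subr_ge0// mulrBl.
- by rewrite mul1r mul0r subr0.
Qed.

(* Points of the ball near [a] can be retracted towards [p] along geodesics, by
   the same amount as [a]; by properness the retracted points are close to one
   another, and they lie deep enough inside the ball to be joined within it. *)
Lemma closed_ball_locally_joined (R : realType) (T : metricType R) (p a : T)
    (r e : R) : proper_space T -> geodesic_space T ->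
  mdist p a <= r -> 0 < e ->
  exists2 eta, 0 < eta & forall b, mdist p b <= r -> mdist a b < eta ->
    joined_in (mclosed_ball p r) a b e.
Proof.
move=> pT gT par e0.
have gj := geodesic_joined gT.
have [pa|ra] := ltP (mdist p a) r.
  exists (Num.min e (r - mdist p a)); first by rewrite lt_min e0 subr_gt0.
  move=> b pb; rewrite lt_min => /andP[abe abr].
  apply: joined_le (ltW abe) _; apply: gj => z az zb.
  rewrite /mclosed_ball /= (le_trans (metric_triangle _ a _))//; lra.
have {par ra}pa : mdist p a = r by apply/eqP; rewrite eq_le par.
have r0 : 0 <= r by rewrite -pa mdist_ge0.
pose k := e / 4; have k0 : 0 < k by rewrite divr_gt0.
(* In a ball this small, the path through the centre has length at most [2 * r], which is below
   [e]. *)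
have [rk|kr] := leP r k.
  exists 1 => // b pb _.
  have E4 : e = k + k + (k + k) by rewrite /k; lra.
  rewrite E4; apply: (@joined_le _ _ _ _ _ _ _ _ (r + r)); first lra.
  apply: (@joined_cat _ _ _ _ _ _ _ p).
    apply: joined_sym; apply: (joined_le (L := mdist p a)); first by rewrite pa.
    by apply: gj => z pz _; rewrite /mclosed_ball /= -pa.
  apply: (joined_le (L := mdist p b)); first by rewrite pb.
  by apply: gj => z pz _; rewrite /mclosed_ball /= (le_trans pz).
have retr b : exists c, mdist p b <= r -> mdist p c <= r - k /\ mdist c b <= k.
  have [g [g0 g1 gL]] := gT p b.
  have [bk|bk] := leP (mdist p b) k.
    by exists p => _; rewrite mdistxx subr_ge0 (ltW kr).
  have b0 : 0 < mdist p b by exact: lt_trans bk.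
  pose t := 1 - k / mdist p b.
  have kb1 : k / mdist p b <= 1 by rewrite ler_pdivrMr// mul1r ltW.
  have kb0 : 0 <= k / mdist p b by rewrite divr_ge0// ltW.
  have I0 : 0 <= (0 : R) <= 1 by rewrite lexx ler01.
  have I1 : 0 <= (1 : R) <= 1 by rewrite lexx ler01.
  have t01 : 0 <= t <= 1 by rewrite /t; apply/andP; split; lra.
  exists (g t) => pbr; split.
    rewrite -[X in mdist X _ <= _]g0 (le_trans (gL _ _ I0 t01))//.
    rewrite sub0r normrN ger0_norm; last by case/andP: t01.
    by rewrite mulrBl mul1r divfK ?gt_eqF// lerB.
  rewrite -[X in mdist _ X <= _]g1 (le_trans (gL _ _ t01 I1))//.
  by rewrite /t distrC opprB addrC subrK ger0_norm// divfK// gt_eqF.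
have [F HF] := choice retr.
(* Otherwise some points [b n] tending to [a] cannot be joined to it. Their retractions have a limit
   [c], and the path through [c] and [F (b n)] consists of three pieces of length at most [k]. *)
apply: contrapT => noeta.
have bad (n : nat) : exists b, [/\ mdist p b <= r, mdist a b < n.+1%:R^-1 &
    ~ joined_in (mclosed_ball p r) a b e].
  apply: contrapT => nb; apply: noeta; exists n.+1%:R^-1; first by rewrite invr_gt0.
  by move=> b pb ab; apply: contrapT => nj; apply: nb; exists b.
have [b Hb] := choice bad.
have [U [UU infU]] := ultraFilterLemma eventually_filter.
have [|c] := compact_ultra_lim UU (pT p (r - k)) (u := fun n => F (b n)).
  by move=> n; have [pb _ _] := Hb n; have [] := HF _ pb.
rewrite /mclosed_ball /= => pc Uc.
have small (d : R) : 0 < d -> U [set n | n.+1%:R^-1 < d].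
  move=> d0; apply: infU; near=> n.
  rewrite /= -[ltRHS]invrK ltf_pV2 ?posrE ?invr_gt0//.
  rewrite (lt_trans (y := n%:R)) ?ltr_nat//.
  by near: n; exact: nbhs_infty_gtr.
have ca : mdist c a <= k.
  apply/ler_addgt0Pl => d d0; have d2 : 0 < d / 2 by rewrite divr_gt0.
  have [n [/= n1 n2]] := filter_ex (filterI (Uc _ d2) (small _ d2)).
  have [pb ab _] := Hb n; have [_ Fb] := HF _ pb.
  have tri1 := metric_triangle c (F (b n)) a.
  have tri2 := metric_triangle (F (b n)) (b n) a.
  have abd := lt_trans ab n2.
  by rewrite (metric_sym (b n)) in tri2; lra.
have [n /= cn] := filter_ex (Uc _ k0).
have [pb _] := Hb n; have [pF Fb] := HF _ pb; apply.
have E4 : e = k + (k + k) + k by rewrite /k; lra.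
apply: (joined_le (L := mdist a c + mdist c (F (b n)) + mdist (F (b n)) (b n))).
  by rewrite (metric_sym a); lra.
have inA x z : mdist p x <= r - k -> mdist x z <= k -> mclosed_ball p r z.
  by move=> px xz; rewrite /mclosed_ball /= (le_trans (metric_triangle _ x _))//; lra.
apply: (@joined_cat _ _ _ _ _ _ _ (F (b n))).
  apply: (@joined_cat _ _ _ _ _ _ _ c).
    rewrite metric_sym; apply: joined_sym; apply: gj => z cz _.
    by apply: (inA c) => //; exact: le_trans ca.
  by apply: gj => z cz _; apply: (inA c) => //; rewrite (le_trans cz)// ltW.
by apply: gj => z cz _; apply: (inA (F (b n))) => //; exact: le_trans Fb.
Unshelve. all: by end_near. Qed.

(** * Uniform lifting in a covering *)

Section LiftingRadius.
Variables (R : realType) (X Y : metricType R) (pi : Y -> X).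

(** Even covering in metric form: lifting near [x] does not increase distances, and distinct points
    of the fibre over [x] are at distance at least [d]. *)
Definition lifts_within (d : R) (x : X) :=
  (forall y x', pi y = x -> mdist x x' < d ->
     exists2 y', pi y' = x' & mdist y y' <= mdist x x') /\
  (forall y y', pi y = x -> pi y' = x -> mdist y y' < d -> y' = y).

Hypothesis X_length : length_space X.
Hypothesis pi_lifted : lifted_length_metric pi.
Hypothesis pi_cover : covering_onto [set: X] pi.

Lemma dominates_mdist (T : metricType R) (l : R -> R) (g : R -> T) t :
  dominates l g -> 0 <= t <= 1 -> mdist (g 0) (g t) <= l 1 - l 0.
Proof.
move=> lg /andP[t0 t1].
have := lg 0 t (lexx _) t0 t1; have := lg t 1 t0 t1 (lexx _).
by have := mdist_ge0 (g t) (g 1); lra.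
Qed.

(** For existence, the local section carries an almost minimal path of [X] into the sheet of [y].
    For uniqueness, an almost minimal path of [Y] projects into [U], so by disjointness and openness
    of the sheets it never leaves its first one. *)
Lemma evenly_covered_lifts (d : R) (x : X) (U : set X) (F : set (set Y)) :
  (forall x', mdist x x' < d -> U x') ->
  trivIset F id -> \bigcup_(S in F) S = pi @^-1` U ->
  (forall S, F S -> open S /\ exists s : X -> Y,
      [/\ {within [set: X] `&` U, continuous s},
          forall z, ([set: X] `&` U) z -> S (s z) /\ pi (s z) = z
        & forall e, S e -> s (pi e) = e]) ->
  lifts_within d x.
Proof.
move=> dU trivF covF HF; split=> [y x' yx xx'|y y' yx y'x yy'].
  have Ux : U x by apply: dU; rewrite mdistxx; exact: le_lt_trans (mdist_ge0 _ _) xx'.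
  have : (\bigcup_(S in F) S) y by rewrite covF /= yx.
  move=> [S FS Sy]; have [_ [s [sc sS spi]]] := HF S FS.
  exists (s x'); first by apply: (sS _ _).2; split => //; exact: dU.
  apply/ler_addgt0Pl => e e0.
  have [|g [l [[gc g0 g1] lg lL]]] :=
      (* The bound [d] keeps the path inside [U]; the other bound makes it almost minimal. *)
      @lifted_approx _ _ _ _ X_length x x' (Num.min d (e + mdist x x')).
    by rewrite lt_min xx' ltrDr.
  move: lL; rewrite lt_min => /andP[ld le].
  have gU t : 0 <= t <= 1 -> ([set: X] `&` U) (g t).
    move=> t01; split => //; apply: dU; rewrite -g0.
    exact: le_lt_trans (dominates_mdist lg t01) ld.
  rewrite (le_trans _ (ltW le))//.
  apply: (lifted_mdist_le pi_lifted (g := s \o g)); last first.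
    move=> u v u0 uv v1 /=.
    by rewrite (sS _ (gU u _)).2 ?(sS _ (gU v _)).2; [exact: lg| |];
      rewrite ?u0 ?v1 ?andbT ?(le_trans uv)//= (le_trans u0).
  split; rewrite /= ?g1// ?g0; last by rewrite -yx spi.
  apply/within_itvP => t t01 e' e'0.
  have /subspace_continuousP/(_ _ (gU _ t01)) := sc.
  move=> /metricType_numDomainType.cvgrPdist_lt/(_ _ e'0).
  rewrite near_withinE => /nbhs_ballP[r /= r0 Hr].
  have [eta eta0 Heta] := (iffLR (within_itvP _) gc) t t01 r r0.
  exists eta => // u u01 ut; apply: Hr; last exact: gU.
  by rewrite ballEmdist; exact: Heta.
have [g [l [[gc g0 g1] lg lL]]] := lifted_approx pi_lifted yy'.
have gU t : 0 <= t <= 1 -> U (pi (g t)).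
  move=> t01; apply: dU; rewrite -yx -g0.
  exact: le_lt_trans (dominates_mdist lg t01) lL.
have sheet t : 0 <= t <= 1 -> exists2 S, F S & S (g t).
  by move=> /gU; rewrite -[U _]/((pi @^-1` U) _) -covF => -[S ? ?]; exists S.
have I0 : 0 <= (0 : R) <= 1 by rewrite lexx ler01.
have I1 : 0 <= (1 : R) <= 1 by rewrite lexx ler01.
have [S FS Sy] := sheet _ I0.
have Sg : forall t, 0 <= t <= 1 -> S (g t).
  apply: locally_constant_itv => // t t01.
  have [S' FS' S'g] := sheet _ t01; have [oS' _] := HF _ FS'.
  have /nbhs_ballP[r /= r0 Hr] := open_nbhs_nbhs (conj oS' S'g).
  have [eta eta0 Heta] := (iffLR (within_itvP _) gc) t t01 r r0.
  exists eta => // u u01 ut.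
  have S'u : S' (g u) by apply: Hr; rewrite ballEmdist; exact: Heta.
  have SS' v : S (g v) -> S' (g v) -> S = S'.
    by move=> Sv S'v; apply: (trivF S S') => //; exists (g v).
  by split => [Su|St]; [rewrite (SS' u) | rewrite (SS' t)].
have [_ [s [_ _ spi]]] := HF S FS.
have <- : s (pi y') = y' by apply: spi; rewrite -g1; exact: Sg.
by rewrite y'x -yx; apply: spi; rewrite -g0.
Qed.

Lemma lifting_radius (K : set X) : compact K ->
  exists2 d : R, 0 < d & forall x, K x -> lifts_within d x.
Proof.
move=> cK.
have := iffLR (compact_near_coveringP _) cK R (0^'+) (fun d x => lifts_within d x) _ _.
case=> [x Kx|e /= e0 He].
  have [_ _ /(_ x I)[U [oU Ux [F [trivF covF HF]]]]] := pi_cover.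
  have /nbhs_ballP[r /= r0 Hr] := open_nbhs_nbhs (conj oU Ux).
  exists (ball x (r / 2), [set d | d < r / 2]) => /=.
    split; first by apply: nbhsx_ballx; rewrite divr_gt0.
    by apply: nbhs_right_lt; rewrite divr_gt0.
  move=> [z d] /= []; rewrite ballEmdist /= => xz dr.
  apply: (evenly_covered_lifts (U := U) _ trivF covF HF) => x' zx'.
  apply: Hr; rewrite ballEmdist /=.
  by rewrite (le_lt_trans (metric_triangle _ z _))//; lra.
have e2 : 0 < e / 2 by rewrite divr_gt0.
exists (e / 2) => //; apply: He => //=.
by rewrite sub0r normrN gtr0_norm// ltr_pdivrMr// ltr_pMr// ltr1n.
Qed.

End LiftingRadius.

(** * The pulled back covering *)

Section MetricTopology.
Variables (R : realType) (S T : metricType R).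

Lemma lipschitz_continuous (q : S -> T) :
  (forall u v, mdist (q u) (q v) <= mdist u v) -> continuous q.
Proof.
move=> qL u; apply/metricType_numDomainType.cvgrPdist_lt => d d0.
apply/nbhs_ballP; exists d => // v; rewrite ballEmdist /=.
exact: le_lt_trans (qL _ _).
Qed.

Lemma open_mdistP (A : set S) :
  (forall u, A u -> exists2 d, 0 < d & forall v, mdist u v < d -> A v) -> open A.
Proof.
move=> HA; rewrite openE => u /HA[d d0 Hd]; apply/nbhs_ballP.
by exists d => // v; rewrite ballEmdist; exact: Hd.
Qed.

Lemma within_mdistP (A : set S) (s : S -> T) :
  (forall x, A x -> forall d, 0 < d -> exists2 k, 0 < k &
     forall y, A y -> mdist x y < k -> mdist (s x) (s y) < d) ->
  {within A, continuous s}.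
Proof.
move=> Hs; apply/subspace_continuousP => x Ax.
apply/metricType_numDomainType.cvgrPdist_lt => d d0.
have [k k0 Hk] := Hs x Ax d d0.
rewrite near_withinE; apply/nbhs_ballP; exists k => // y.
by rewrite ballEmdist /= => xy Ay; exact: Hk.
Qed.

End MetricTopology.

Record metric_axioms (R : realType) (S : Type) (d : S -> S -> R) := MetricAxioms {
  ma_refl : forall x, d x x = 0;
  ma_pos : forall x y, d x y = 0 -> x = y;
  ma_sym : forall x y, d x y = d y x;
  ma_triangle : forall y x z, d x z <= d x y + d y z
}.

(** An alias indexed by the proof of the axioms, so that a distance constructed inside a section
    becomes a [metricType]. *)
Definition metric_of (R : realType) (S : Type) (d : S -> S -> R)
  (_ : metric_axioms d) : Type := S.

HB.instance Definition _ R S d (H : @metric_axioms R S d) :=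
  gen_eqMixin (metric_of H).
HB.instance Definition _ R S d (H : @metric_axioms R S d) :=
  gen_choiceMixin (metric_of H).
HB.instance Definition _ R S d (H : @metric_axioms R S d) :=
  isMetric.Build R (metric_of H)
    (ma_refl H) (ma_pos H) (ma_sym H) (ma_triangle H).

Section PulledBackCover.
Variables (R : realType) (M X Y : metricType R) (pi : Y -> X) (f : M -> X).
Variables (p : M) (y0 : Y) (r h e : R).
Hypotheses (M_proper : proper_space M) (M_geodesic : geodesic_space M).
Hypotheses (r_ge0 : 0 <= r) (h_gt0 : 0 < h) (e_lt_h : e < h) (e_le1 : e <= 1).
Hypothesis pi_lipschitz : forall y z, mdist (pi y) (pi z) <= mdist y z.
Hypothesis pi_lifts :
  forall x, mdist (f p) x <= r + 1 -> lifts_within pi (16 * h) x.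
Hypothesis f_approx : forall a b, mdist p a <= r -> mdist p b <= r ->
  `|mdist (f a) (f b) - mdist a b| < e.
Hypothesis y0_lift : pi y0 = f p.

Definition pullback : set (M * Y) :=
  [set u | mdist p u.1 <= r /\ pi u.2 = f u.1].

(** The threshold lies between [2 * h], attained by lifts over short displacements, and [8 * h], the
    range of [same_sheet_mdist]. Two points within [2 * h] of a third one always satisfy it. *)
Definition same_sheet (u v : M * Y) := mdist u.2 v.2 < 4 * h.

Local Notation J := (joined (@fst M Y) same_sheet pullback).

Lemma f_lt a b : mdist p a <= r -> mdist p b <= r ->
  mdist (f a) (f b) < mdist a b + e.
Proof. by move=> pa pb; have := f_approx pa pb; rewrite ltr_norml => /andP[]; lra. Qed.

Lemma f_lifts a : mdist p a <= r -> lifts_within pi (16 * h) (f a).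
Proof.
move=> pa; apply: pi_lifts; have pp : mdist p p <= r by rewrite mdistxx.
by have := f_lt pp pa; move: e_le1; lra.
Qed.

Lemma same_sheet_refl u : same_sheet u u.
Proof. by rewrite /same_sheet mdistxx mulr_gt0. Qed.

Lemma lift_unique a y z : mdist p a <= r -> pi y = f a -> pi z = f a ->
  mdist y z < 16 * h -> z = y.
Proof. by move=> pa ya za; have [_] := f_lifts pa; apply. Qed.

(** Lifting [pi v.2] from [u.2] gives a point [z] within [8 * h] of [u.2], hence within [16 * h] of
    [v.2]; by uniqueness [z] is [v.2]. Thus the distance in [Y] is the one in [X], which [f]
    controls. *)
Lemma same_sheet_mdist u v : pullback u -> pullback v ->
  mdist u.2 v.2 < 8 * h -> mdist u.2 v.2 < mdist u.1 v.1 + e.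
Proof.
move=> [pu uE] [pv vE] uv; apply: le_lt_trans (f_lt pu pv).
rewrite -uE -vE.
have [/(_ _ (pi v.2) uE) H _] := f_lifts pu.
have uv' := le_lt_trans (pi_lipschitz u.2 v.2) uv.
have [|z zv uz] := H; first by rewrite -uE; move: h_gt0 => ?; lra.
rewrite -uE in uz; suff zE : z = v.2 by rewrite zE in uz.
apply: (lift_unique pv) => //; first by rewrite zv.
have := metric_triangle v.2 u.2 z; rewrite (metric_sym v.2 u.2).
by move=> ?; lra.
Qed.

(** The gap argument. From a [Y]-distance below [2 * h], a jump below [4 * h] leads to less than
    [8 * h], which improves again to less than [2 * h]. *)
Lemma joined_short u v L : J u v L -> L < h -> mdist u.2 v.2 < 2 * h.
Proof.
move=> [g [l [[g0 g1] gA gc lg lL]]] Lh.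
have He : e < h := e_lt_h; have h0 : 0 < h := h_gt0.
have I0 : 0 <= (0 : R) <= 1 by rewrite lexx ler01.
have I1 : 0 <= (1 : R) <= 1 by rewrite lexx ler01.
have near t : 0 <= t <= 1 -> mdist (g 0).1 (g t).1 < h.
  by move=> t01; have := dominates_mdist lg t01; rewrite /=; lra.
have better t : 0 <= t <= 1 -> mdist (g 0).2 (g t).2 < 8 * h ->
    mdist (g 0).2 (g t).2 < 2 * h.
  move=> t01 /(same_sheet_mdist (gA _ I0) (gA _ t01)); have := near _ t01.
  by move=> ? ?; lra.
suff H : forall t : R, 0 <= t <= 1 -> mdist (g 0).2 (g t).2 < 2 * h.
  by rewrite -g0 -g1; exact: H.
apply: locally_constant_itv; first by rewrite mdistxx mulr_gt0.
move=> t t01; have [eta eta0 Heta] := gc t t01 h h_gt0.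
exists eta => // s s01 st; have [_ ts] := Heta s s01 st.
rewrite /same_sheet in ts; split=> H.
  apply: better => //; have := metric_triangle (g 0).2 (g s).2 (g t).2.
  by rewrite (metric_sym (g s).2); move=> ?; lra.
apply: better => //; have := metric_triangle (g 0).2 (g t).2 (g s).2.
by move=> ?; lra.
Qed.

Lemma lift_ball a y : pullback (a, y) -> exists G : M -> Y,
  forall c, mdist p c <= r -> mdist a c < h ->
    pi (G c) = f c /\ mdist y (G c) < 2 * h.
Proof.
move=> [pa ya]; have He : e < h := e_lt_h.
suff H : forall c, exists z, mdist p c <= r -> mdist a c < h ->
    pi z = f c /\ mdist y z < 2 * h by have [G HG] := choice H; exists G.
move=> c; have [pc|pc] := pselect (mdist p c <= r); last by exists y.
have [ac|ac] := pselect (mdist a c < h); last by exists y.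
have fac := f_lt pa pc.
have [/(_ _ (f c) ya) H _] := f_lifts pa.
have [|z zc yz] := H; first by move: h_gt0 => ?; lra.
by exists z => _ _; split => //; rewrite (le_lt_trans yz)//; lra.
Qed.

(** The path is lifted point by point, through the lifts [G] near [y]. Nothing makes these depend
    continuously on the point, but all lie within [2 * h] of [y], which is what [same_sheet]
    asks. *)
Lemma lift_short a b y L : joined_in (mclosed_ball p r) a b L -> L < h ->
  pi y = f a -> exists z, [/\ pullback (b, z), J (a, y) (b, z) L & mdist y z < 2 * h].
Proof.
move=> [g [l [[g0 g1] gA gc lg lL]]] Lh ya.
have I0 : 0 <= (0 : R) <= 1 by rewrite lexx ler01.
have I1 : 0 <= (1 : R) <= 1 by rewrite lexx ler01.
have pa : mdist p a <= r by rewrite -g0; exact: gA.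
have near t : 0 <= t <= 1 -> mdist a (g t) < h.
  by move=> t01; have := dominates_mdist lg t01; rewrite /= g0; lra.
have [G HG] := @lift_ball a y (conj pa ya).
have Ga : G a = y.
  have [|Ga yGa] := HG a pa; first by rewrite mdistxx.
  by apply: (lift_unique pa) => //; move: h_gt0 => ?; lra.
have HGt t (t01 : 0 <= t <= 1) := HG (g t) (gA t t01) (near t t01).
exists (G b); rewrite -g1; split; last by have [] := HGt _ I1.
  by split; [exact: gA | have [] := HGt _ I1].
exists (fun t => (g t, G (g t))), l; split => //.
- by rewrite g0 Ga.
- by move=> t t01; split; [exact: gA | have [] := HGt _ t01].
- move=> t t01 d d0; have [eta eta0 Heta] := gc t t01 d d0.
  exists eta => // s s01 st; have [ts _] := Heta s s01 st; split => //.
  rewrite /same_sheet /=; have [_ yt] := HGt _ t01; have [_ ys] := HGt _ s01.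
  have := metric_triangle (G (g t)) y (G (g s)); rewrite (metric_sym _ y).
  by move=> ?; lra.
Qed.

Lemma lift_short_to a b y z L : joined_in (mclosed_ball p r) a b L -> L < h ->
  pi y = f a -> pi z = f b -> mdist y z < 4 * h -> J (a, y) (b, z) L.
Proof.
move=> ab Lh ya zb yz; have [z' [[/= pb z'b] Jz yz']] := lift_short ab Lh ya.
suff -> : z = z' by [].
apply: (lift_unique pb) => //; have := metric_triangle z' y z.
by rewrite (metric_sym z' y); move: h_gt0 => ? ?; lra.
Qed.

Lemma pullback_locally_joined u (d : R) : pullback u -> 0 < d ->
  exists2 eta, 0 < eta & forall v, pullback v -> mdist u.1 v.1 < eta ->
    same_sheet u v -> J u v d.
Proof.
case: u => a y [/= pa ya] d0.
have m0 : 0 < Num.min d (h / 2) by rewrite lt_min d0 divr_gt0.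
have [eta eta0 Heta] := closed_ball_locally_joined M_proper M_geodesic pa m0.
exists eta => // -[b z] [/= pb zb] ab yz.
apply: (joined_le (L := Num.min d (h / 2))); first by rewrite ge_min lexx.
apply: lift_short_to => //; first exact: Heta.
by rewrite gt_min ltr_pdivrMr// ltr_pMr// ltr1n orbT.
Qed.

Definition component : set (M * Y) :=
  [set u | pullback u /\ exists L, J (p, y0) u L].

Lemma component_closed u v L : component u -> pullback v -> J u v L -> component v.
Proof.
move=> [_ [K uK]] Av uv; split => //; exists (K + L).
exact: joined_cat uK uv.
Qed.

Lemma component_base : component (p, y0).
Proof.
have pb : pullback (p, y0) by split; rewrite //= mdistxx.
by split => //; exists 0; apply: joined_refl => //; exact: same_sheet_refl.
Qed.

(** Along a geodesic from [p], having a point of the component above is locally constant, since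
    short paths in the ball lift in both directions. *)
Lemma component_onto a : mdist p a <= r -> exists y, component (a, y).
Proof.
move=> pa.
have [|g [l [[g0 g1] gA gc _ _]]] :=
    @geodesic_joined _ _ (mclosed_ball p r) p a M_geodesic.
  by move=> z pz _; exact: le_trans pa.
suff H : forall t : R, 0 <= t <= 1 -> exists y, component (g t, y).
  by rewrite -g1; apply: H; rewrite lexx ler01.
apply: locally_constant_itv; first by exists y0; rewrite g0; exact: component_base.
move=> t t01.
have h2 : 0 < h / 2 by rewrite divr_gt0.
have hh : h / 2 < h by rewrite ltr_pdivrMr// ltr_pMr// ltr1n.
have [d d0 Hd] := closed_ball_locally_joined M_proper M_geodesic (gA t t01) h2.
have [eta eta0 Heta] := gc t t01 d d0.
exists eta => // s s01 st; have [ts _] := Heta s s01 st.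
have tsJ := Hd (g s) (gA s s01) ts.
split=> -[y Cy]; have [[/= py yE] _] := Cy.
  have [z [Az Jz _]] := lift_short (joined_sym tsJ) hh yE.
  by exists z; exact: component_closed Cy Az Jz.
have [z [Az Jz _]] := lift_short tsJ hh yE.
by exists z; exact: component_closed Cy Az Jz.
Qed.

(** * The component as a metric space covering the ball *)

Let cover := {u : M * Y | component u}.

Let cdist (u v : cover) : R := inf [set L | J (sval u) (sval v) L].

Let J_ge0 u v L : J u v L -> 0 <= L.
Proof. by move=> uv; have := joined_mdist uv; exact/le_trans/mdist_ge0. Qed.

Let J_cover (u v : cover) : exists L, J (sval u) (sval v) L.
Proof.
have [_ [L Lu]] := svalP u; have [_ [K Kv]] := svalP v.
by exists (L + K); apply: joined_cat Kv; exact: joined_sym.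
Qed.

Let lbJ (u v : cover) : lbound [set L | J (sval u) (sval v) L] 0.
Proof. by move=> L /J_ge0. Qed.

Let cdist_ge0 (u v : cover) : 0 <= cdist u v.
Proof. by apply: lb_le_inf; [exact: J_cover | exact: lbJ]. Qed.

Let cdist_le (u v : cover) L : J (sval u) (sval v) L -> cdist u v <= L.
Proof. by move=> uv; apply: ge_inf => //; exists 0; exact: lbJ. Qed.

Let cdist_lt (u v : cover) L : cdist u v < L -> J (sval u) (sval v) L.
Proof.
move=> uvL; have [||K /= uvK KL] :=
    @inf_adherent _ [set L | J (sval u) (sval v) L] (L - cdist u v).
- by rewrite subr_gt0.
- by split; [exact: J_cover | exists 0; exact: lbJ].
by move: KL; rewrite addrC subrK => /ltW KL; exact: joined_le KL uvK.
Qed.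

Let cover_axioms : metric_axioms cdist.
Proof.
split.
- move=> u; apply/eqP; rewrite eq_le cdist_ge0 andbT; apply: cdist_le.
  by apply: joined_refl; [have [] := svalP u | exact: same_sheet_refl].
(* At distance zero the base points agree, and paths shorter than [h] put the two lifts within
   [2 * h] of each other, so they agree by uniqueness. *)
- move=> u v uv0.
  have uv L : 0 < L -> J (sval u) (sval v) L by rewrite -uv0; exact: cdist_lt.
  have [[pu uE] _] := svalP u; have [[pv vE] _] := svalP v.
  have E1 : (sval u).1 = (sval v).1.
    apply: mdist_positivity; apply/eqP; rewrite eq_le mdist_ge0 andbT.
    by apply/ler_addgt0Pl => d d0; rewrite addr0; exact: joined_mdist (uv d d0).
  have h2 : 0 < h / 2 by rewrite divr_gt0.
  have hh : h / 2 < h by rewrite ltr_pdivrMr// ltr_pMr// ltr1n.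
  have E2 : (sval v).2 = (sval u).2.
    apply: (lift_unique pu) => //; first by rewrite vE E1.
    by have := joined_short (uv _ h2) hh; move: h_gt0 => ? ?; lra.
  apply: eq_sig_hprop; first by move=> ? ? ?; exact: Prop_irrelevance.
  by rewrite [LHS]surjective_pairing [RHS]surjective_pairing E1 E2.
- have H u v : cdist u v <= cdist v u.
    apply/ler_addgt0Pl => d d0; apply: cdist_le; apply: joined_sym.
    by apply: cdist_lt; rewrite ltrDr.
  by move=> u v; apply/eqP; rewrite eq_le !H.
- move=> v u w; apply/ler_addgt0Pl => d d0; apply: cdist_le.
  have d2 : 0 < d / 2 by rewrite divr_gt0.
  apply: (joined_le (L := (cdist u v + d / 2) + (cdist v w + d / 2))); first by lra.
  by apply: (@joined_cat _ _ _ _ _ _ _ (sval v)); apply: cdist_lt; rewrite ltrDl.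
Qed.

Let B : metricType R := metric_of cover_axioms.
Let q (u : B) : M := (sval (u : cover)).1.
Let F (u : B) : Y := (sval (u : cover)).2.

Let mdistB (u v : B) : mdist u v = cdist u v. Proof. by []. Qed.

Let B_pullback (u : B) : pullback (sval (u : cover)).
Proof. by have [] := svalP (u : cover). Qed.

Let q_lipschitz (u v : B) : mdist (q u) (q v) <= mdist u v.
Proof.
apply/ler_addgt0Pl => d d0.
have uvd : mdist u v < d + mdist u v by rewrite ltrDr.
exact: joined_mdist (cdist_lt uvd).
Qed.

Let B_short (u v : B) : mdist u v < h -> mdist (F u) (F v) < 2 * h.
Proof.
move=> uvh; have := midf_lt uvh => -[L1 L2].
by apply: joined_short L2; exact: cdist_lt.
Qed.

(** The converse of [q_lipschitz] and [B_short]: together they identify convergence in [B] with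
    convergence in [M] within a sheet, hence continuity of paths with [path_cont]. *)
Let B_local (u : B) d : 0 < d -> exists2 eta, 0 < eta & forall v : B,
  mdist (q u) (q v) < eta -> mdist (F u) (F v) < 4 * h -> mdist u v < d.
Proof.
move=> d0; have d2 : 0 < d / 2 by rewrite divr_gt0.
have [eta eta0 Heta] := pullback_locally_joined (B_pullback u) d2.
exists eta => // v quv Fuv.
have /cdist_le := Heta _ (B_pullback v) quv Fuv.
by move=> H; rewrite mdistB (le_lt_trans H)// ltr_pdivrMr// ltr_pMr// ltr1n.
Qed.

Let B_path_cont (g : R -> B) : {within `[0, 1], continuous g} <->
  path_cont (@fst M Y) same_sheet (fun t => sval (g t : cover)).
Proof.
split=> [/within_itvP gc t t01 d d0|gc].
  have m0 : 0 < Num.min d h by rewrite lt_min d0.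
  have [eta eta0 Heta] := gc t t01 _ m0; exists eta => // s s01 st.
  have := Heta s s01 st; rewrite lt_min => /andP[ts th]; split.
    exact: le_lt_trans (q_lipschitz _ _) ts.
  rewrite /same_sheet (lt_trans (B_short th))// ltr_pM2r//.
  by rewrite ltr_nat.
apply/within_itvP => t t01 d d0.
have [a a0 Ha] := B_local (g t) d0.
have [eta eta0 Heta] := gc t t01 a a0; exists eta => // s s01 st.
by have [H1 H2] := Heta s s01 st; exact: Ha.
Qed.

Let q_lifted : lifted_length_metric q.
Proof.
apply: lifted_length_metricI => [u v g l [gc g0 g1] lg|u v d d0].
  apply: cdist_le; exists (fun t => sval (g t : cover)), l; split => //.
  - by rewrite g0 g1.
  - exact/B_path_cont.
have uvd : cdist u v < cdist u v + d by rewrite ltrDl.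
have [g [l [[g0 g1] gA gc lg lL]]] := cdist_lt uvd.
(* A path in [B] must take values in the component for every real parameter, whereas [g] is
   controlled only on the unit interval; hence the clamping. *)
pose cl (t : R) := Num.max 0 (Num.min 1 t).
have cl01 t : 0 <= cl t <= 1.
  by rewrite /cl le_max lexx/= ge_max ler01 ge_min lexx.
have clE t : 0 <= t <= 1 -> cl t = t.
  by move=> /andP[t0 t1]; rewrite /cl min_r// max_r.
have gC t : component (g (cl t)).
  have /andP[t0 t1] := cl01 t.
  apply: component_closed (svalP (u : cover)) (gA _ (cl01 t)) _.
  by rewrite -[sval (u : cover)]g0; exact: joined_sub gA gc lg _ _ (lexx _) t0 t1.
exists (fun t => exist _ _ (gC t) : B), l; split => //.
  split.
  - apply/B_path_cont => t t01 b b0; have [eta eta0 Heta] := gc t t01 b b0.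
    by exists eta => // s s01 st; rewrite /= !clE//; exact: Heta.
  - apply: eq_sig_hprop; first by move=> ? ? ?; exact: Prop_irrelevance.
    by rewrite /= clE ?lexx ?ler01.
  - apply: eq_sig_hprop; first by move=> ? ? ?; exact: Prop_irrelevance.
    by rewrite /= clE ?lexx ?ler01.
move=> s t s0 st t1 /=; rewrite /q /= !clE; first exact: lg.
  by rewrite (le_trans s0 st).
by rewrite s0 (le_trans st).
Qed.

Let q_covering : covering_onto (mclosed_ball p r) q.
Proof.
have q_cont := lipschitz_continuous q_lipschitz.
split => //.
  apply/seteqP; split => [_ [u _ <-]|a pa]; first by have [] := B_pullback u.
  by have [y Cy] := component_onto pa; exists (exist _ _ Cy : B).
move=> a pa.
have h2 : 0 < h / 2 by rewrite divr_gt0.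
have hh : h / 2 < h by rewrite ltr_pdivrMr// ltr_pMr// ltr1n.
have [eta eta0 Heta] := closed_ball_locally_joined M_proper M_geodesic pa h2.
exists (ball a eta); split; [|exact: ballxx|].
  apply: open_mdistP => b; rewrite ballEmdist /= => ab.
  exists (eta - mdist a b); rewrite ?subr_gt0// => c bc.
  by rewrite (le_lt_trans (metric_triangle _ b _))//; move: bc; lra.
(* Sheets are indexed by the fibre over [a]. They are disjoint because two points of that fibre
   closer than [4 * h] coincide. *)
pose sheet y : set B := [set u | mdist a (q u) < eta /\ mdist y (F u) < 2 * h].
exists [set sheet y | y in [set y | component (a, y)]].
have h0 := h_gt0.
split.
- move=> _ _ [y [[_ ya] _] <-] [z [[_ za] _] <-] [u [[_ uy] [_ uz]]].
  suff -> : y = z by [].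
  apply: (lift_unique pa) => //.
  have := metric_triangle z (F u) y; rewrite (metric_sym (F u)).
  by move=> ?; lra.
- apply/seteqP; split => [u [_ [y _ <-] [au _]]|u]; first by rewrite /= ballEmdist.
  rewrite /= ballEmdist /= => au.
  have [[pu uE] _] := svalP (u : cover).
  have [y [Ay Jy uy]] := lift_short (joined_sym (Heta _ pu au)) hh uE.
  exists (sheet y).
    exists y => //; apply: component_closed Ay Jy.
    by rewrite -surjective_pairing; exact: svalP.
  by split => //; rewrite metric_sym.
move=> _ [y Cy <-]; have [[_ ya] _] := Cy.
split.
  apply: open_mdistP => u [au uy].
  exists (Num.min (eta - mdist a (q u)) h); first by rewrite lt_min subr_gt0 au.
  move=> v; rewrite lt_min => /andP[uv uvh].
  have av : mdist a (q v) < eta.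
    rewrite (le_lt_trans (metric_triangle _ (q u) _))//.
    by have := q_lipschitz u v; lra.
  split => //.
  (* Moving inside [B] weakens the bound [2 * h] to [4 * h]; this still allows a short path from
     [(a, y)], along which [joined_short] restores [2 * h]. *)
  have yv : mdist y (F v) < 4 * h.
    rewrite (le_lt_trans (metric_triangle _ (F u) _))//.
    by have := B_short uvh; lra.
  have Jav : J (a, y) (sval (v : cover)) (h / 2).
    have [[pv vE] _] := svalP (v : cover).
    rewrite [sval _]surjective_pairing.
    exact: lift_short_to (Heta _ pv av) hh _ _ yv.
  exact: joined_short Jav hh.
have /choice[s Hs] : forall b, exists v : B, mdist p b <= r -> mdist a b < eta ->
    sheet y v /\ q v = b.
  move=> b; have [pb|pb] := pselect (mdist p b <= r); last first.
    by exists (exist _ _ component_base : B).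
  have [ab|ab] := pselect (mdist a b < eta); last first.
    by exists (exist _ _ component_base : B).
  have [z [Az Jz yz]] := lift_short (Heta _ pb ab) hh ya.
  by exists (exist _ _ (component_closed Cy Az Jz) : B).
exists s; split.
- apply: within_mdistP => b [/= pb]; rewrite ballEmdist /= => ab d d0.
  have [[_ yb] sb] := Hs b pb ab.
  have [k k0 Hk] := B_local (s b) d0.
  exists k => // c [pc ac] bc.
  have [[_ yc] sc] := Hs c pc ac.
  apply: Hk; first by rewrite sb sc.
  have := metric_triangle (F (s b)) y (F (s c)); rewrite (metric_sym _ y).
  by move=> ?; lra.
- move=> b [pb]; rewrite ballEmdist /= => ab; exact: Hs.
- move=> u [au yu]; have [[pu uE] _] := svalP (u : cover).
  have [[_ ys] sE] := Hs (q u) pu au.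
  have [[_ sE'] _] := svalP (s (q u) : cover).
  apply: eq_sig_hprop; first by move=> ? ? ?; exact: Prop_irrelevance.
  rewrite [LHS]surjective_pairing [RHS]surjective_pairing; congr (_, _); first exact: sE.
  apply: (lift_unique pu) => //; first by rewrite sE' -/(q _) sE.
  have := metric_triangle (F u) y (F (s (q u))); rewrite (metric_sym _ y).
  by rewrite /F; move: ys yu; rewrite /F; move=> ? ? ?; lra.
Qed.

(** The last clause compares the metric of the cover with that of [M]: its first premise keeps a
    minimal geodesic from [q u] to [a] inside the ball, and this geodesic lifts. *)
Theorem pulled_back_cover : exists (B : metricType R) (q : B -> M) (F : B -> Y) (b : B),
  [/\ covering_onto (mclosed_ball p r) q, lifted_length_metric q,
      [/\ q b = p, F b = y0, forall u, pi (F u) = f (q u)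
        & forall u v, q u = q v -> F u = F v -> u = v],
      forall u v, mdist u v < h -> mdist (F u) (F v) < mdist u v + e
    & forall u a y, mdist p (q u) + mdist (q u) a <= r -> mdist (q u) a < h ->
        pi y = f a -> mdist (F u) y < 4 * h ->
        exists v, [/\ q v = a, F v = y & mdist u v <= mdist (q u) a]].
Proof.
exists B, q, F, (exist _ _ component_base : B); split => //.
  split => // [u|u v qE FE]; first by have [] := B_pullback u.
  apply: eq_sig_hprop; first by move=> ? ? ?; exact: Prop_irrelevance.
  by rewrite [LHS]surjective_pairing [RHS]surjective_pairing; congr (_, _).
  move=> u v uv; have := B_short uv; have h0 := h_gt0; move=> Fuv.
  have H : mdist (F u) (F v) < mdist (q u) (q v) + e.
    apply: same_sheet_mdist; [exact: B_pullback|exact: B_pullback|].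
    by rewrite -/(F u) -/(F v); lra.
  by rewrite (lt_le_trans H)// lerD2r.
move=> u a y ua uah ya Fuy.
have [[pu uE] _] := svalP (u : cover).
have paa : mdist p a <= r by exact: le_trans (metric_triangle _ (q u) _) ua.
have Jua : J (sval (u : cover)) (a, y) (mdist (q u) a).
  rewrite [sval _]surjective_pairing.
  apply: lift_short_to => //; apply: geodesic_joined => // z uz _.
  by rewrite /mclosed_ball /= (le_trans (metric_triangle _ (q u) _))// (le_trans _ ua)// lerD2l.
have Aay : pullback (a, y) by split.
have Cay := component_closed (svalP (u : cover)) Aay Jua.
by exists (exist _ _ Cay : B); split => //; exact: cdist_le.
Qed.

End PulledBackCover.

(** * Comparison of distances *)

Section CoverApproximation.
Variables (R : realType) (M X Y B : metricType R) (pi : Y -> X) (f : M -> X).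
Variables (q : B -> M) (F : B -> Y) (p : M) (r h e : R).
Hypotheses (h_gt0 : 0 < h) (e_gt0 : 0 < e) (e_lt_h : 8 * e <= h).
Hypotheses (Y_interp : interpolable Y) (B_interp : interpolable B).
Hypothesis pi_lipschitz : forall y z, mdist (pi y) (pi z) <= mdist y z.
Hypothesis pi_lifts :
  forall x, mdist (f p) x <= r + 1 -> lifts_within pi (16 * h) x.
Hypothesis f_approx : forall a b, mdist p a <= r -> mdist p b <= r ->
  `|mdist (f a) (f b) - mdist a b| < e.
Hypothesis f_onto : forall x, mdist (f p) x < r - 2 * e ->
  exists2 a, mdist p a <= r & mdist (f a) x < e.
Hypothesis F_lift : forall u, pi (F u) = f (q u).
Hypothesis F_short :
  forall u v, mdist u v < h -> mdist (F u) (F v) < mdist u v + e.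
Hypothesis F_lifts : forall u a y,
  mdist p (q u) + mdist (q u) a <= r -> mdist (q u) a < h ->
  pi y = f a -> mdist (F u) y < 4 * h ->
  exists v, [/\ q v = a, F v = y & mdist u v <= mdist (q u) a].

(** The chain is taken in [B], in steps of length [h / 2]. Each costs [e] through [F_short] and less
    than [e] through interpolation. *)
Lemma F_upper (n : nat) u v : mdist u v < n%:R * (h / 2) ->
  mdist (F u) (F v) <= mdist u v + n%:R * (2 * e).
Proof.
have h0 := h_gt0; have e0 := e_gt0.
elim: n u => [|n IH] u; first by rewrite mul0r ltNge mdist_ge0.
rewrite -natr1 => uv.
have ne0 : 0 <= n%:R * (2 * e) by rewrite mulr_ge0// mulr_ge0// ltW.
have [uvh|huv] := ltP (mdist u v) (h / 2).
  have uvh' : mdist u v < h by lra.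
  by have := F_short uvh'; move=> ?; lra.
(* The interpolation error must also be smaller than the slack in the strict hypothesis, so that the
   remaining distance fits [n] steps. *)
pose m := Num.min e ((n%:R + 1) * (h / 2) - mdist u v).
have m0 : 0 < m by rewrite lt_min e0 subr_gt0.
have m2 : 0 < m / 2 by rewrite divr_gt0.
have [|w uw wv] := B_interp (x := u) (y := v) (s := h / 2) _ m2.
  by rewrite huv divr_ge0// ltW.
have me : m <= e by rewrite ge_min lexx.
have ms : m <= (n%:R + 1) * (h / 2) - mdist u v by rewrite ge_min lexx orbT.
have wvn : mdist w v < n%:R * (h / 2) by lra.
have H1 := IH _ wvn.
have H2 : mdist (F u) (F w) < mdist u w + e by apply: F_short; lra.
have := metric_triangle (F u) (F w) (F v).
by move=> ?; lra.
Qed.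

(** The chain is taken in [Y]. Each intermediate point [w] is replaced by a nearby lift [w'] of some
    [f b] and then lifted to [B]. A step approaches [y] by at least [h / 2 - 2 * e], hence by
    [h / 4], moves the base point by less than [2 * h] and costs at most [6 * e]. *)
Lemma F_lower (n : nat) u a y : pi y = f a -> mdist p a <= r ->
  mdist p (q u) + n%:R * (2 * h) <= r -> mdist (F u) y < n%:R * (h / 4) ->
  exists v, [/\ q v = a, F v = y & mdist u v <= mdist (F u) y + n%:R * (6 * e)].
Proof.
have h0 := h_gt0; have e0 := e_gt0; have eh := e_lt_h.
move=> ya pa.
elim: n u => [|n IH] u; first by rewrite !mul0r [_ < 0]ltNge mdist_ge0.
rewrite -natr1 => pqu uy.
have nh0 : 0 <= n%:R * (2 * h) by rewrite mulr_ge0// mulr_ge0// ltW.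
have ne0 : 0 <= n%:R * (6 * e) by rewrite mulr_ge0// mulr_ge0// ltW.
have pu : mdist p (q u) <= r by lra.
have [uyh|huy] := ltP (mdist (F u) y) (h / 2).
  have qua : mdist (q u) a < mdist (F u) y + e.
    have := f_approx pu pa; rewrite ltr_norml => /andP[H _].
    by have := pi_lipschitz (F u) y; rewrite F_lift ya => ?; lra.
  have [|||v [va vy uv]] := @F_lifts u a y _ _ ya; [lra|lra|lra|].
  by exists v; split => //; lra.
have [|w uw wy] := Y_interp (x := F u) (y := y) (s := h / 2) _ e0.
  by rewrite huy divr_ge0// ltW.
have pp : mdist p p <= r by rewrite mdistxx; exact: le_trans (mdist_ge0 _ _) pu.
have pw : mdist (f p) (pi w) < r - 2 * e.
  have := f_approx pp pu; rewrite ltr_norml => /andP[_ H].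
  have := metric_triangle (f p) (f (q u)) (pi w).
  by have := pi_lipschitz (F u) w; rewrite F_lift => ? ?; lra.
have [b pb bw] := f_onto pw.
have [|lw _] := pi_lifts (x := pi w); first lra.
have [|w' w'b ww'] := lw w (f b) erefl; first by rewrite metric_sym; lra.
rewrite metric_sym in bw.
have uw' : mdist (F u) w' < h / 2 + e.
  by have := metric_triangle (F u) w w'; move=> ?; lra.
have qub : mdist (q u) b < h / 2 + 2 * e.
  have := f_approx pu pb; rewrite ltr_norml => /andP[H _].
  by have := pi_lipschitz (F u) w'; rewrite F_lift w'b => ?; lra.
have [|||v [vb vw' uv]] := @F_lifts u b w' _ _ w'b; [lra|lra|lra|].
have w'y : mdist (F v) y <= mdist (F u) y - h / 2 + 2 * e.
  by have := metric_triangle w' w y; rewrite vw' (metric_sym w' w); move=> ?; lra.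
have [||v' [v'a v'y vv']] := IH v.
- have := metric_triangle p (q u) (q v); rewrite vb => ?; lra.
- lra.
exists v'; split => //.
by have := metric_triangle u v v' => ?; lra.
Qed.

End CoverApproximation.

(** * The approximation at a given scale and the choice of the constants *)

Definition covers_approximate (R : realType) (X Y M : metricType R)
    (pi : Y -> X) (y0 : Y) (p : M) (K t r : R) :=
  exists (B : metricType R) (q : B -> M) (F : B -> Y) (b : B),
  [/\ covering_onto (mclosed_ball p r) q, lifted_length_metric q,
      q b = p /\ F b = y0,
      forall u v, mdist b u < K -> mdist b v < K ->
        `|mdist (F u) (F v) - mdist u v| < t
    & forall y, mdist y0 y < K - t -> exists2 u, mdist b u < K & mdist (F u) y < t].

(* A chain of [N] steps reaches distance [N * (h / 4)], which must exceed [2 * K],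
   and drifts by at most [2 * h] per step: this bounds [N * (2 * h)] by
   [16 * K + 10], so that the radius [r] does not depend on [h]. *)
Lemma exists_approximating_cover (R : realType) (X Y : metricType R)
    (pi : Y -> X) (y0 : Y) (K t : R) :
  length_space X -> proper_space X -> lifted_length_metric pi ->
  covering_onto [set: X] pi -> 0 < K -> 0 < t ->
  let r := 17 * K + 20 in
  exists2 e : R, 0 < e & forall (M : metricType R) (p : M) (f : M -> X),
    proper_space M -> geodesic_space M -> f p = pi y0 ->
    (forall a b, mdist p a < r + 1 -> mdist p b < r + 1 ->
      `|mdist (f a) (f b) - mdist a b| < e) ->
    (forall x, mdist (pi y0) x < r + 1 - e ->
      exists2 a, mdist p a < r + 1 & mdist (f a) x < e) ->
    covers_approximate pi y0 p K t r.
Proof.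
move=> X_length X_proper pi_lifted pi_cover K0 t0 r.
have r0 : 0 < r by rewrite /r; lra.
have [d d0 Hd] := lifting_radius X_length pi_lifted pi_cover (X_proper (pi y0) (r + 1)).
pose h := Num.min 1 (d / 16).
have h0 : 0 < h by rewrite lt_min ltr01 divr_gt0.
have h1 : h <= 1 by rewrite ge_min lexx.
have hd : 16 * h <= d by rewrite mulrC -ler_pdivlMr// ge_min lexx orbT.
pose N := (Num.truncn (4 * (2 * K + 1) / h)).+1.
have K4 : 0 <= 4 * (2 * K + 1) / h by rewrite divr_ge0 ?(ltW h0)//; lra.
have [N1 N2] : 2 * K + 1 < N%:R * (h / 4) /\ N%:R * h <= 4 * (2 * K + 1) + h.
  have /andP[N1 N2] := truncn_itv K4.
  rewrite ltr_pdivrMr// in N2; rewrite ler_pdivlMr// in N1.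
  by split; [rewrite -/N in N2; lra | rewrite /N -natr1 mulrDl mul1r lerD2r].
have N0 : 1 <= N%:R :> R by rewrite ler1n.
(* [F_lower] loses [6 * e] per step; the factor 8 leaves room for the approximation of the target
   itself. The bound by [1] keeps [mdist (F u) (F v)] below [2 * K + 1]. *)
pose e := Num.min (h / 8) (Num.min 1 t / (8 * N%:R)).
have m0 : 0 < Num.min 1 t by rewrite lt_min ltr01.
have e0 : 0 < e by rewrite lt_min !divr_gt0// mulr_gt0// (lt_le_trans ltr01).
have eh : 8 * e <= h by rewrite mulrC -ler_pdivlMr// ge_min lexx.
have eN : N%:R * (8 * e) <= Num.min 1 t.
  rewrite mulrCA mulrA mulrC -ler_pdivlMr ?ge_min ?lexx ?orbT//.
  by rewrite mulr_gt0// (lt_le_trans ltr01).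
have /andP[eN1 eNt] : (N%:R * (8 * e) <= 1) && (N%:R * (8 * e) <= t).
  by move: eN; rewrite le_min.
have Ne : e <= N%:R * e by rewrite ler_peMl// ltW.
have lifts x : mdist (pi y0) x <= r + 1 -> lifts_within pi (16 * h) x.
  move=> xr; have [H1 H2] := Hd _ xr; split=> [y x' yx xx'|y y' yx y'x yy'].
    by apply: H1 => //; exact: lt_le_trans hd.
  by apply: H2 => //; exact: lt_le_trans hd.
exists e => // M p f M_proper M_geo fp f_approx f_onto.
have f_approx' a b : mdist p a <= r -> mdist p b <= r ->
    `|mdist (f a) (f b) - mdist a b| < e.
  by move=> pa pb; apply: f_approx; lra.
have f_onto' x : mdist (f p) x < r - 2 * e ->
    exists2 a, mdist p a <= r & mdist (f a) x < e.
  (* The point [a] is known only to lie in the ball of radius [r + 1]. As [f a] is close to [x], the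
     distance estimate puts [a] within [r]. *)
  rewrite fp => xr; have [|a pa ax] := f_onto x; first lra.
  exists a => //.
  have pp : mdist p p < r + 1 by rewrite mdistxx; lra.
  have := f_approx _ _ pp pa; rewrite ltr_norml => /andP[H _].
  have := metric_triangle (pi y0) x (f a).
  by rewrite (metric_sym x) -fp in xr *; move=> ?; lra.
have lifts' x : mdist (f p) x <= r + 1 -> lifts_within pi (16 * h) x.
  by rewrite fp; exact: lifts.
have pi_lip := lifted_lipschitz pi_lifted.
have [||B [q [F [b [q_cov q_lift [qb Fb F_lift qF_inj] F_short F_lifts]]]]] :=
  pulled_back_cover M_proper M_geo (ltW r0) h0 (e :=
      e) _ _ pi_lip lifts' f_approx' (esym fp);
  [lra|lra|].
have Y_interp := lifted_interpolable pi_lifted.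
have B_interp := lifted_interpolable q_lift.
have q_lip := lifted_lipschitz q_lift.
have upper := @F_upper _ Y B F h e h0 e0 B_interp F_short.
have lower := @F_lower _ M X Y B pi f q F p r h e h0 e0 eh Y_interp pi_lip
  lifts' f_approx' f_onto' F_lift F_lifts.
exists B, q, F, b; split => //.
  move=> u v bu bv.
  have uv : mdist u v < 2 * K.
    by have := metric_triangle u b v; rewrite (metric_sym u b) => ?; lra.
  have H1 : mdist (F u) (F v) <= mdist u v + N%:R * (2 * e) by apply: upper; lra.
  have pqu : mdist p (q u) < K by rewrite -qb (le_lt_trans (q_lip _ _)).
  have pqv : mdist p (q v) < K by rewrite -qb (le_lt_trans (q_lip _ _)).
  (* The lift ending over [q v] with value [F v] is [v] itself, by injectivity of the pair
     [(q, F)]. *)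
  have [|||v' [qv' Fv' uv']] :=
      lower N u (q v) (F v) (F_lift v); [by rewrite /r; lra|by rewrite /r; lra|lra|].
  rewrite (qF_inj _ _ qv' Fv') in uv'.
  by rewrite ltr_norml; apply/andP; split; lra.
move=> y yK.
have pyr : mdist (f p) (pi y) < r - 2 * e.
  by have := pi_lip y0 y; rewrite fp /r; lra.
have [a pa ay] := f_onto' _ pyr.
have [|ly _] := lifts' (pi y); first lra.
have [|y' y'a yy'] := ly y (f a) erefl; first by rewrite metric_sym; lra.
rewrite metric_sym in ay.
have y0y' : mdist y0 y' < K - t + e.
  by have := metric_triangle y0 y y'; move=> ?; lra.
have [||u [qu Fu bu]] := lower N b a y' y'a pa.
- by rewrite qb mdistxx /r; lra.
- by rewrite Fb; lra.
rewrite Fb in bu; exists u; first lra.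
by rewrite Fu metric_sym; lra.
Qed.

(** * Riemannian manifolds *)

Lemma aff_is_derive (R : realType) (a b x : R) : is_derive x 1 (aff a b) (b - a).
Proof.
rewrite /aff. apply: is_derive_eq. by rewrite add0r mul1r /GRing.scale /= mulr1.
Qed.

Lemma derive1_comp_aff (R : realType) (V : normedModType R) (F : R -> V)
    (a b s : R) : derivable F (aff a b s) 1 ->
  derivable (F \o aff a b) s 1 /\
  derive1 (F \o aff a b) s = (b - a) *: derive1 F (aff a b s).
Proof.
move=> /derivable1_diffP ds.
have [/derivable1_diffP da aE] := aff_is_derive a b s.
have dca := differentiable_comp da ds.
split; first exact/derivable1_diffP.
rewrite (derive1E' dca) (derive1E' ds).
apply: etrans (congr1 (fun L : R -> V => L 1) (diff_comp da ds)) _ => /=.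
rewrite -(derive1E' da) derive1E aE -[RHS]linearZ /=.
by rewrite /GRing.scale /= mulr1.
Qed.

Lemma integral_aff (R : realType) (G : R -> R) (a b : R) :
  a <= b -> {within `[a, b], continuous G} ->
  (\int[lebesgue_measure]_(x in `[a, b]) (G x)%:E =
   \int[lebesgue_measure]_(x in `[0%R, 1%R]) (G (aff a b x) * (b - a))%:E)%E.
Proof.
rewrite le_eqVlt => /predU1P[<- _|ab cG].
  rewrite set_itv1 integral_set1.
  by under eq_integral do rewrite subrr mulr0; rewrite integral0.
have D : (aff a b)^`()%classic = cst (b - a).
  by apply/funext => x; rewrite derive1E; apply: derive_val; exact: aff_is_derive.
have ca : continuous (aff a b).
  move=> x; apply: differentiable_continuous; apply/derivable1_diffP.
  by have [] := aff_is_derive a b x.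
rewrite -[in LHS](aff0 a b) -[in X in `[_, X]](aff1 a b).
rewrite (@integration_by_substitution_increasing _ (aff a b))//.
- by apply: eq_integral => x _; rewrite /= D.
- by move=> x y _ _ xy; rewrite /aff ltrD2l ltr_pM2l// subr_gt0.
- by move=> x _; rewrite D; exact: cvg_cst.
- by rewrite D; exact: is_cvg_cst.
- by rewrite D; exact: is_cvg_cst.
- split; first by move=> x _; have [] := aff_is_derive a b x.
    by apply: cvg_at_right_filter; exact: ca.
  by apply: cvg_at_left_filter; exact: ca.
- by rewrite aff0 aff1.
Qed.

Lemma integral_split (R : realType) (G : R -> R) (t : R) : 0 <= t <= 1 ->
  {within `[0, 1], continuous G} ->
  (\int[lebesgue_measure]_(x in `[0%R, 1%R]) (G x)%:E =
   \int[lebesgue_measure]_(x in `[0%R, t]) (G x)%:E +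
   \int[lebesgue_measure]_(x in `[t, 1%R]) (G x)%:E)%E.
Proof.
move=> /andP[t0 t1] cG.
have mG : measurable_fun (`[0, 1] : set R) G by apply: subspace_continuous_measurable_fun.
rewrite (@itv_bndbnd_setU _ _ _ (BRight t)); last 2 first.
- by rewrite bnd_simp.
- by rewrite bnd_simp.
rewrite -(integral_itv_obnd_cbnd (r := t)); last first.
  apply/measurable_EFinP; apply: measurable_funS mG => // x /=.
  by rewrite !in_itv /= => /andP[tx ->]; rewrite (le_trans t0)// ltW.
rewrite integral_setU//=.
  by apply/measurable_EFinP; rewrite -itv_bndbnd_setU ?bnd_simp.
apply/disj_setPRL => x /=. 
by rewrite !in_itv /= => /andP[tx _] /andP[_]; rewrite leNgt tx.
Qed.

Lemma eq_continuous_at (T U : topologicalType) (f g : T -> U) (x : T) :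
  f =1 g -> {for x, continuous f} -> {for x, continuous g}.
Proof. by move=> /funext ->. Qed.

Lemma continuous_bigsum (R : realType) (T : topologicalType) (I : Type)
    (s : seq I) (F : I -> T -> R) (x : T) :
  (forall i, {for x, continuous (F i)}) ->
  {for x, continuous (fun y => \sum_(i <- s) F i y)}.
Proof.
move=> Fc; elim: s => [|i s IH].
  apply: (eq_continuous_at (f := fun=> 0)); last exact: cvg_cst.
  by move=> y; rewrite big_nil.
apply: (eq_continuous_at (f := fun y => F i y + \sum_(j <- s) F j y)).
  by move=> y; rewrite big_cons.
by apply: continuousD => //; exact: Fc.
Qed.

Lemma continuous_qform (R : realType) (n : nat) (T : topologicalType)
    (A : T -> 'M[R]_n) (v : T -> 'rV[R]_n) (x : T) :
  (forall i j, {for x, continuous (fun y => A y i j)}) ->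
  (forall j, {for x, continuous (fun y => v y 0 j)}) ->
  {for x, continuous (fun y => qform (A y) (v y))}.
Proof.
move=> Ac vc.
apply: (eq_continuous_at (f := fun y => \sum_j (\sum_k v y 0 k * A y k j) * v y 0 j)).
  by move=> y; rewrite /qform mxE; apply: eq_bigr => j _; rewrite !mxE.
apply: continuous_bigsum => j; apply: continuousM => //.
by apply: continuous_bigsum => k; apply: continuousM.
Qed.

Lemma qformZ (R : realType) (n : nat) (A : 'M[R]_n) (c : R) (v : 'rV[R]_n) :
  qform A (c *: v) = c ^+ 2 * qform A v.
Proof. by rewrite /qform linearZ /= -!scalemxAl -scalemxAr scalerA [LHS]mxE expr2. Qed.

Lemma continuous_to_open (T U : topologicalType) (f : T -> U) (t : T) (A : set U) :
  {for t, continuous f} -> open A -> A (f t) -> \forall s \near t, A (f s).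
Proof. by move=> fc oA Aft; apply: fc; exact: open_nbhs_nbhs. Qed.

Lemma near_continuous (T U : topologicalType) (f : T -> U) (t : T) (P : U -> Prop) :
  {for t, continuous f} -> nbhs (f t) P -> nbhs t (fun s => P (f s)).
Proof. by move=> fc; exact: fc. Qed.

Section Arcs.
Variables (R : realType) (n : nat) (M : riemannian_manifold R n).
Local Notation phi := (@rm_chart R n M).
Local Notation g := (@rm_metric R n M).

Definition C1_arc (eta : R -> M) (v : R -> R) :=
  (forall t, 0 <= t <= 1 -> C1_at phi eta t) /\
  (forall t i, 0 <= t <= 1 -> ch_dom (phi i) (eta t) -> v t = speed_in phi g i eta t).

Lemma speed_in_continuous i eta t : C1_at phi eta t -> ch_dom (phi i) (eta t) ->
  {for t, continuous (speed_in phi g i eta)}.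
Proof.
move=> [ec /(_ i)] H di; have [dn dc] := H di.
apply: (@continuous_comp _ _ _ (fun s => qform (g i (ch_map (phi i) (eta s))) _) Num.sqrt);
  last exact: sqrt_continuous.
apply: continuous_qform => [k l|j]; last first.
  by apply: (@continuous_comp _ _ _ _ (fun M : 'rV[R]_n => M 0 j)); [exact: dc|exact: coord_continuous].
have mc : {for t, continuous (fun s => ch_map (phi i) (eta s))}.
  apply: differentiable_continuous; apply/derivable1_diffP.
  exact: nbhs_singleton dn.
apply: (@continuous_comp _ _ _ (fun s => ch_map (phi i) (eta s)) (fun u => g i u k l)) => //.
have [|gc _] := @rm_metric_smooth _ _ M i k l [::] (ch_map (phi i) (eta t)) _.
  by exists (eta t).
exact: gc.
Qed.

(** Chart domains are open, so near each parameter [v] is the speed read in one single chart. *)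
Lemma C1_arc_continuous eta v : C1_arc eta v -> {within `[0, 1], continuous v}.
Proof.
move=> [ec Hv]; apply: within_itv_realP => t t01 e e0.
have [i di] := rm_cover (eta t).
have /cvgrPdist_lt/(_ _ e0) sc := speed_in_continuous (ec t t01) di.
have [etac _] := ec t t01.
have dn := continuous_to_open etac (@ch_dom_open _ _ _ (phi i)) di.
have [d /= d0 Hd] := iffLR (nbhs_ballP _ _) (filterI sc dn).
exists d => // s s01; rewrite distrC => st; have [/= ss ds] := Hd s st.
by rewrite (Hv t i t01 di) (Hv s i s01 ds).
Qed.

Section Restriction.
Variables (a b : R).
Hypotheses (a0 : 0 <= a) (ab : a <= b) (b1 : b <= 1).

Lemma C1_at_aff eta t : C1_at phi eta (aff a b t) -> C1_at phi (eta \o aff a b) t.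
Proof.
have ac : continuous (aff a b).
  move=> x; apply: differentiable_continuous; apply/derivable1_diffP.
  by have [] := aff_is_derive a b x.
move=> [ec H]; split; first by apply: continuous_comp => //; exact: ac.
move=> i di; have [dn dc] := H i di.
pose D (u : R) := derivable (fun r => ch_map (phi i) (eta r)) u 1.
have dn' : nbhs t (fun s => D (aff a b s)) := near_continuous (ac t) dn.
have deq s : derivable (fun r => ch_map (phi i) (eta r)) (aff a b s) 1 ->
    derivable (fun r => ch_map (phi i) ((eta \o aff a b) r)) s 1 /\
    derive1 (fun r => ch_map (phi i) ((eta \o aff a b) r)) s =
    (b - a) *: derive1 (fun r => ch_map (phi i) (eta r)) (aff a b s).
  exact: (@derive1_comp_aff R _ (fun r => ch_map (phi i) (eta r)) a b s).
split; first by apply: filterS dn' => s /deq[].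
have [_ Dt] := deq t (nbhs_singleton dn).
suff : derive1 (fun r => ch_map (phi i) ((eta \o aff a b) r)) s @[s --> t] -->
    derive1 (fun r => ch_map (phi i) ((eta \o aff a b) r)) t by [].
rewrite Dt; apply: cvg_trans.
  apply: near_eq_cvg; first by apply: filterS dn' => s /deq[_]; exact: esym.
apply: cvgZr.
exact: (continuous_comp (ac t) dc).
Qed.

Lemma C1_arc_aff eta v : C1_arc eta v ->
  C1_arc (eta \o aff a b) (fun u => v (aff a b u) * (b - a)).
Proof.
move=> [ec Hv]; split=> [t t01|t i t01 di]; first exact/C1_at_aff/ec/aff01.
have t01' := aff01 a0 ab b1 t01.
rewrite (Hv _ i t01' di) /speed_in.
have [_ /(_ i di)[dn _]] := ec _ t01'.
have [_] :=
    @derive1_comp_aff R _ (fun r => ch_map (phi i) (eta r)) a b t (nbhs_singleton dn).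
rewrite -[derive1 (_ \o _) t]/(derive1 (fun r => ch_map (phi i) ((eta \o aff a b) r)) t) => ->.
by rewrite qformZ sqrtrM ?sqr_ge0// sqrtr_sqr ger0_norm ?subr_ge0// mulrC.
Qed.

End Restriction.


Local Notation PL := (pw_C1_length phi g).

Lemma pw_C1_arc eta v y L : C1_arc eta v -> PL (eta 1) y L ->
  PL (eta 0) y (\int[lebesgue_measure]_(t in `[0%R, 1%R]) (v t)%:E + L)%E.
Proof. by move=> [ec Hv]; exact: pw_C1_cons. Qed.

Lemma pw_C1_mdist x y L : PL x y L -> ((mdist x y)%:E <= L)%E.
Proof. by move=> xyL; rewrite rm_distance; exact: ereal_inf_lbound. Qed.

Lemma C1_arc_split eta v y L t : C1_arc eta v -> PL (eta 1) y L -> 0 <= t <= 1 ->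
  exists L1 L2, [/\ PL (eta 0) (eta t) L1, PL (eta t) y L2 &
    (L1 + L2 = \int[lebesgue_measure]_(t in `[0%R, 1%R]) (v t)%:E + L)%E].
Proof.
move=> ev yL /[dup] t01 /andP[t0 t1].
have ev1 := C1_arc_aff (lexx 0) t0 t1 ev.
have ev2 := C1_arc_aff t0 t1 (lexx 1) ev.
have vc := C1_arc_continuous ev.
have := @pw_C1_arc _ _ (eta t) 0 ev1; rewrite /= aff0 aff1 => /(_ (pw_C1_nil _ _ _)) H1.
have := @pw_C1_arc _ _ y L ev2; rewrite /= aff0 aff1 => /(_ yL) H2.
eexists; eexists; split; [exact: H1|exact: H2|].
rewrite adde0 addeA; congr (_ + _)%E.
rewrite (integral_split t01 vc).
rewrite (integral_aff t0); last first.
  apply: continuous_subspaceW vc => x /=; rewrite !in_itv /= => /andP[-> xt].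
  exact: le_trans t1.
rewrite (integral_aff t1)//.
apply: continuous_subspaceW vc => x /=; rewrite !in_itv /= => /andP[tx ->].
by rewrite (le_trans t0).
Qed.

(** The reference point [w] is independent of [x], since the induction moves the starting point from
    arc to arc. The cut lies on an arc across whose ends the distance from [w] passes the value
    [s]. *)
Lemma pw_C1_split x y L : PL x y L -> forall (w : M) s,
  mdist w x <= s <= mdist w y ->
  exists z L1 L2, [/\ mdist w z = s, PL x z L1, PL z y L2 & (L1 + L2 = L)%E].
Proof.
elim=> [{}x w s /andP[xs sx]|eta v {}y {}L ec Hv yL IH w s /andP[xs sy]].
  exists x, 0%E, 0%E; split; [|exact: pw_C1_nil|exact: pw_C1_nil|exact: adde0].
  by apply/eqP; rewrite eq_le xs.
have ev : C1_arc eta v by split.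
have [s1|s1] := leP s (mdist w (eta 1)); last first.
  have [|z [L1 [L2 [zs H1 H2 <-]]]] := IH w s; first by rewrite sy ltW.
  exists z; eexists; exists L2; split => //; first exact: pw_C1_arc ev H1.
  by rewrite addeA.
have fc : {within `[0, 1], continuous (fun t => mdist w (eta t))}.
  apply: within_itv_realP => t t01 e e0; have [etac _] := ec t t01.
  have /metricType_numDomainType.cvgrPdist_lt/(_ _ e0) sc := etac.
  have [d /= d0 Hd] := iffLR (nbhs_ballP _ _) sc.
  exists d => // u u01; rewrite distrC => ut.
  exact: le_lt_trans (mdist_diff _ _ _) (Hd u ut).
have [|t] := @IVT R _ 0 1 s ler01 fc.
  by rewrite ge_min xs le_max s1 orbT.
rewrite in_itv /= => t01 ts.
have [L1 [L2 [H1 H2 L12]]] := C1_arc_split ev yL t01.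
by exists (eta t), L1, L2.
Qed.

Lemma riemannian_interpolable : interpolable M.
Proof.
move=> x y s e /andP[s0 sxy] e0.
have : ((mdist x y)%:E < (mdist x y + e)%:E)%E by rewrite lte_fin ltrDl.
rewrite {1}rm_distance => /ereal_inf_lt[L /= xyL Le].
have [|z [L1 [L2 [zs H1 H2 L12]]]] := pw_C1_split xyL (w := x) (s := s).
  by rewrite mdistxx s0.
exists z => //.
have := leeD (pw_C1_mdist H1) (pw_C1_mdist H2); rewrite L12 zs -EFinD.
by move=> /le_lt_trans/(_ Le); rewrite lte_fin => ?; lra.
Qed.

Lemma riemannian_locally_compact (x : M) :
  exists2 r : R, 0 < r & compact (mclosed_ball x r).
Proof.
have [i di] := rm_cover x; pose c := phi i.
have imgc : (ch_map c @` ch_dom c) (ch_map c x) by exists x.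
have [d /= d0 Hd] :=
    iffLR (nbhs_ballP _ _) (open_nbhs_nbhs (conj (@ch_img_open _ _ _ c) imgc)).
have d2 : 0 < d / 2 by rewrite divr_gt0.
pose K := closed_ball (ch_map c x) (d / 2).
have Kimg : K `<=` ch_map c @` ch_dom c.
  by apply: subset_trans Hd; exact: subset_closure_half.
have cK : compact K.
  apply: bounded_closed_compact; last exact: closed_ball_closed.
  exists (`|ch_map c x| + d); split; first exact: num_real.
  move=> B /ltW HB u /(subset_closure_half d0) uK; apply: le_trans HB.
  have := ler_normB (ch_map c x) (ch_map c x - u); rewrite opprB addrC subrK.
  move=> /le_trans; apply; rewrite lerD2l ltW//.
  by move: uK; rewrite -ball_normE.
have cN : compact (ch_inv c @` K).
  apply: continuous_compact cK.
  exact: continuous_subspaceW Kimg (@ch_inv_cont _ _ _ c).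
have xN : \forall y \near x, ch_dom c y /\ ball (ch_map c x) (d / 2) (ch_map c y).
  have mc : {for x, continuous (ch_map c)}.
    have :=
        @ch_map_cont _ _ _ c; rewrite continuous_open_subspace; last exact: ch_dom_open.
    by apply; rewrite inE.
  apply: filterI; first exact: open_nbhs_nbhs (conj (@ch_dom_open _ _ _ c) di).
  by apply: mc; exact: nbhsx_ballx.
have [r /= r0 Hr] := iffLR (nbhs_ballP _ _) xN.
exists (r / 2); first by rewrite divr_gt0.
apply: subclosed_compact cN _; first exact: mclosed_ball_closed.
move=> y; rewrite /mclosed_ball /= => xy.
have [|dy yb] := Hr y.
  by rewrite ballEmdist /= (le_lt_trans xy)// ltr_pdivrMr// ltr_pMr// ltr1n.
exists (ch_map c y); last exact: ch_mapK.
exact: subset_closed_ball.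
Qed.

Lemma riemannian_proper : complete_space M -> proper_space M.
Proof.
move=> M_complete; apply: hopf_rinow M_complete riemannian_locally_compact.
exact: riemannian_interpolable.
Qed.

End Arcs.

(** * Limits *)

(** A single sufficiently fine approximation carries a finite net of a ball of some [M n] to a net
    of the ball of [X]. *)
Lemma pointed_GH_limit_proper (R : realType) (M : nat -> metricType R)
    (p : forall i, M i) (X : metricType R) (x0 : X) :
  complete_space X -> (forall i, proper_space (M i)) ->
  pointed_GH_cvg M p x0 -> proper_space X.
Proof.
move=> X_complete M_proper cvgM x s.
suff Hs (s' : R) : 0 <= s' -> compact (mclosed_ball x0 s').
  apply: (subclosed_compact (B := mclosed_ball x0 (mdist x0 x + Num.max 0 s))).
  - exact: mclosed_ball_closed.
  - by apply: Hs; rewrite addr_ge0 ?mdist_ge0// le_max lexx.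
  - move=> y; rewrite /mclosed_ball /= => xy.
    rewrite (le_trans (metric_triangle _ x _))// lerD2l (le_trans xy)//.
    by rewrite le_max lexx orbT.
move=> s0; apply: totally_bounded_compact => //; first exact: mclosed_ball_closed.
move=> d d0; pose e := Num.min (2^-1) (d / 4).
have e0 : 0 < e by rewrite lt_min invr_gt0 ltr0Sn divr_gt0.
have e1 : e <= 2^-1 by rewrite ge_min lexx.
have ed : e <= d / 4 by rewrite ge_min lexx orbT.
have s2 : 0 < s' + 2 by lra.
have [n _ Hn] := cvgM (s' + 2) e s2 e0.
(* The radius [s' + 2] leaves room: a point whose image is near the [s']-ball lies in the closed
   ball of radius [s' + 1], where the net is taken. *)
have [f [fp f_approx f_onto]] := Hn n (leqnn n).
have d4 : 0 < d / 4 by rewrite divr_gt0.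
have [l lK lnet] := compact_net (M_proper n (p n) (s' + 1)) d4.
exists [seq f z | z <- l] => w; rewrite /mclosed_ball /= => xw.
have [|a] := f_onto w; first by rewrite ballEmdist /=; lra.
rewrite ballEmdist /= => pa aw.
have pb : ball (p n) (s' + 2) (p n) by exact: ballxx.
have pb' : ball (p n) (s' + 2) a by rewrite ballEmdist.
have := f_approx _ _ pb pb'; rewrite fp ltr_norml => /andP[H _].
have pas : mdist (p n) a <= s' + 1.
  by have := metric_triangle x0 w (f a); rewrite (metric_sym w) => ?; lra.
have [z zl za] := lnet a pas.
exists (f z); first exact: map_f.
have pz : ball (p n) (s' + 2) z.
  by rewrite ballEmdist /=; have := lK z zl; rewrite /mclosed_ball /= => ?; lra.
have := f_approx _ _ pz pb'; rewrite ltr_norml => /andP[_ H'].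
by have := metric_triangle (f z) (f a) w => ?; lra.
Qed.

Lemma increasing_choice (P : nat -> nat -> Prop) :
  (forall k, \forall n \near \oo, P k n) ->
  exists2 s : nat -> nat, {homo s : i j / (i < j)%N} & forall k, P k (s k).
Proof.
move=> HP.
have [N HN] : exists N : nat -> nat, forall k n, (N k <= n)%N -> P k n.
  have H k : exists N, forall n, (N <= n)%N -> P k n.
    by have [N _ HN] := HP k; exists N => n; exact: HN.
  by have [N HN] := choice H; exists N.
pose s := fix s k := if k is k'.+1 then maxn (N k) (s k').+1 else N 0%N.
exists s; last by case=> [|k]; apply: HN => //=; exact: leq_maxl.
apply: homo_ltn => [|k]; first exact: ltn_trans.
exact: leq_maxr.
Qed.

Lemma diagonal_approximation (R : realType) (Y : nat -> metricType R)
    (y : forall i, Y i) (Z : metricType R) (z : Z) :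
  (forall k : nat, exists f : Y k -> Z,
    [/\ f (y k) = z,
        forall a b, mdist (y k) a < k.+1%:R -> mdist (y k) b < k.+1%:R ->
          `|mdist (f a) (f b) - mdist a b| < k.+1%:R^-1
      & forall w, mdist z w < k.+1%:R - k.+1%:R^-1 ->
          exists2 a, mdist (y k) a < k.+1%:R & mdist (f a) w < k.+1%:R^-1]) ->
  pointed_GH_cvg Y y z.
Proof.
move=> approx r e r0 e0; near=> k.
have rk : r < k.+1%:R.
  rewrite (lt_trans (y := k%:R)) ?ltr_nat//; near: k; exact: nbhs_infty_gtr.
have ek : k.+1%:R^-1 < e / 2.
  rewrite -[ltRHS]invrK ltf_pV2 ?posrE ?invr_gt0 ?divr_gt0//.
  rewrite (lt_trans (y := k%:R)) ?ltr_nat//; near: k; exact: nbhs_infty_gtr.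
have [f [fy f_approx f_onto]] := approx k.
set t := k.+1%:R^-1 in ek f_approx f_onto.
have t0 : 0 < t by rewrite invr_gt0.
set K : R := k.+1%:R in rk f_approx f_onto.
exists f; split => // [a b|w].
  rewrite !ballEmdist /= => ya yb.
  rewrite (lt_trans (f_approx _ _ _ _))//; [exact: lt_trans rk|exact: lt_trans rk|].
  by rewrite (lt_trans ek)// ltr_pdivrMr// ltr_pMr// ltr1n.
rewrite ballEmdist /= => zw.
have [|a ya aw] := f_onto w; first by lra.
exists a; last by lra.
(* The point [a] comes only from the large ball. Its distance from the base point is less than
   [r - e + 2 * t], and [t < e / 2]. *)
rewrite ballEmdist /=.
have yy : mdist (y k) (y k) < K by rewrite mdistxx /K.
have := f_approx _ _ yy ya; rewrite fy ltr_norml => /andP[H _].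
have := metric_triangle z w (f a); rewrite (metric_sym w) => ?.
by lra.
Unshelve. all: by end_near. Qed.

Theorem theorem1p1 (R : realType) (n : nat) (n_gt0 : (0 < n)%N)
  (M : nat -> riemannian_manifold R n) (p : forall i, M i)
  (M_complete : forall i, complete_space (M i))
  (M_ricci : forall i, ricci_bounded_below (M i) (- (n%:R - 1)))
  (X : metricType R) (x0 : X)
  (X_complete : complete_space X) (X_length : length_space X)
  (M_cvg : pointed_GH_cvg (fun i => rm_space (M i)) p x0)
  (Xt : metricType R) (pi : Xt -> X)
  (Xt_universal : universal_cover pi) (Xt_metric : lifted_length_metric pi)
  (xt : Xt) (xt_lift : pi xt = x0) :
  exists (sigma : nat -> nat) (rad : nat -> R)
         (B : nat -> metricType R) (q : forall i, B i -> M (sigma i))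
         (b : forall i, B i),
    [/\ {homo sigma : i j / (i < j)%N},
        rad i @[i --> \oo] --> +oo,
        forall i, covering_onto (mclosed_ball (p (sigma i)) (rad i)) (q i),
        forall i, lifted_length_metric (q i) /\ q i (b i) = p (sigma i)
      & pointed_GH_cvg B b xt].
Proof.
have [_ pi_cover _] := Xt_universal.
have M_proper i : proper_space (M i) by exact: riemannian_proper.
have M_geodesic i : geodesic_space (M i).
  exact: proper_geodesic (@riemannian_interpolable _ _ (M i)) (M_proper i).
have X_proper := pointed_GH_limit_proper X_complete M_proper M_cvg.
pose K (k : nat) : R := k.+1%:R.
pose rad k := 17 * K k + 20.
have [k|sigma sigma_incr Hsigma] :=
  @increasing_choice (fun k i => covers_approximate pi xt (p i) (K k) (K k)^-1 (rad k)).
  have K0 : 0 < K k by rewrite ltr0n.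
  have Ki : 0 < (K k)^-1 by rewrite invr_gt0.
  have [e e0 He] :=
      exists_approximating_cover xt X_length X_proper Xt_metric pi_cover K0 Ki.
  have r0 : 0 < rad k + 1 by rewrite /rad; lra.
  have := M_cvg (rad k + 1) e r0 e0; apply: filterS => i [f [fp f_approx f_onto]].
  apply: (He (M i) (p i) f) => //; first by rewrite fp xt_lift.
    by move=> a b pa pb; apply: f_approx; rewrite ballEmdist.
  move=> x; rewrite xt_lift => xx; have [|a] := f_onto x; first by rewrite ballEmdist.
  by rewrite ballEmdist => ? ?; exists a.
pose approximating k (B : metricType R) (q : B -> M (sigma k)) (b : B) :=
  [/\ covering_onto (mclosed_ball (p (sigma k)) (rad k)) q,
      lifted_length_metric q, q b = p (sigma k)
    & exists f : B -> Xt,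
  [/\ f b = xt,
      forall a a', mdist b a < K k -> mdist b a' < K k ->
        `|mdist (f a) (f a') - mdist a a'| < (K k)^-1
    & forall w, mdist xt w < K k - (K k)^-1 ->
        exists2 a, mdist b a < K k & mdist (f a) w < (K k)^-1]].
(* The types of [q] and [b] depend on [B], so the whole tuple is chosen at once and then
   projected. *)
have C k : {B : metricType R & {q : B -> M (sigma k) & {b : B & approximating k B q b}}}.
  have /cid[B /cid[q /cid[F /cid[b [H1 H2 [H3 H4] H5 H6]]]]] := Hsigma k.
  by exists B, q, b; split => //; exists F.
have [B [q [b HB]]] : exists (B : nat -> metricType R) (q : forall k, B k -> M (sigma k))
    (b : forall k, B k), forall k, approximating k (B k) (q k) (b k).
  exists (fun k => projT1 (C k)), (fun k => projT1 (projT2 (C k))).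
  exists (fun k => projT1 (projT2 (projT2 (C k)))) => k.
  exact: projT2 (projT2 (projT2 (C k))).
exists sigma, rad, B, q, b; split => //.
- apply/cvgryPge => A; near=> k.
  have kA : A <= k%:R by near: k; exact: nbhs_infty_ger.
  by rewrite /rad /K -natr1; have : 0 <= k%:R :> R by []; lra.
- by move=> k; have [] := HB k.
- by move=> k; have [] := HB k.
- by apply: diagonal_approximation => k; have [] := HB k.
Unshelve. all: by end_near. Qed.
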